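(* The number of plane partitions of trapezoidal shape $(N,N-2,\dots,N-2r+2)$ with entries between $0$ and $c$ and where the entries on the main diagonal form a partition with exactly $p$ columns of parity different from $r$ (equivalently, $\sum_{i=1}^{r}(-1)^{r-i+1}a_{ii}=p$ if $r$ is even, respectively $\sum_{i=2}^{r}(-1)^{r-i+1}a_{ii}=p$ if $r$ is odd, with $a_{ii}$ denoting the first entry in row $i$), equals $$\binom cp\,\frac{\binom{p+r-1}{p}}{\binom{N-r+c}{p}}\prod_{1\le i\le r,\ 1\le j\le c}\frac{N-i+j}{i+j-1}.$$ In particular, the number of plane partitions of trapezoidal shape $(N,N-2,\dots,N-2r+2)$ with entries between $0$ and $c$ equals $$\prod_{1\le i\le r,\ 1\le j\le c}\frac{N+1-i+j}{i+j-1}.$$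
   Context: The trapezoidal shape $(N,N-2,\dots,N-2r+2)$ is an array of cells with $r$ rows, each row indented by one cell to the right with respect to the previous row, and with $N-2i+2$ cells in row $i$. A plane partition of this shape is a filling of the trapezoidal shape with nonnegative integers ($0$ is allowed as an entry) such that entries along rows and columns are weakly decreasing. The entries on the main diagonal are the first entries $a_{11},a_{22},\dots,a_{rr}$ of the rows. The columns of a partition $(\lambda_1,\dots,\lambda_r)$ are the columns of its Ferrers diagram, the array of left-justified rows with $\lambda_i$ cells in row $i$; the parity of a column means the parity of its length.
   Formalization: For odd r the first formula is false as stated (N=r=c=1, p=0: count 2, formula 1); there the c−a_11 empty columns of the diagonal partition inside a box with c columns are also counted as having parity different from r, so c−a_11 is added to the alternating sum. Even r and the total are unchanged. *)

(* Defs.v *)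
From mathcomp Require Import all_boot all_order all_algebra.
Set Implicit Arguments.
Unset Strict Implicit.
Unset Printing Implicit Defensive.

(* Rows and columns are numbered from 0: row i < r occupies the columns
   i, ..., N - i - 1, i.e. it has N - 2 i cells. *)
Definition in_trapezoid (N r : nat) (x : 'I_N * 'I_N) : bool :=
  [&& x.1 < r, x.1 <= x.2 & x.2 < N - x.1].

Definition cell (N r : nat) := {x : 'I_N * 'I_N | in_trapezoid r x}.

Definition filling (N r c : nat) := {ffun cell N r -> 'I_c.+1}.

Definition plane_partition (N r c : nat) (a : filling N r c) : bool :=
  [forall x : cell N r, forall y : cell N r,
     (((val x).1 == (val y).1) && ((val x).2 <= (val y).2)
      || ((val x).2 == (val y).2) && ((val x).1 <= (val y).1))
     ==> (a y <= a x)].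

(* The cells of the form (i, i) are exactly those with i < r when
   2 r <= N + 1, so this is the sequence of the r first entries of the rows. *)
Definition diagonal (N r c : nat) (a : filling N r c) : seq nat :=
  pmap (fun i : 'I_N =>
          omap (fun x : cell N r => val (a x)) (insub (i, i)))
       (enum 'I_N).

Definition diag_entry (N r c : nat) (a : filling N r c) (i : nat) : nat :=
  nth 0 (diagonal a) i.-1.

(* The column lengths of the Ferrers diagram of a weakly decreasing sequence. *)
Definition columns (la : seq nat) : seq nat :=
  [seq count (leq j) la | j <- iota 1 (head 0 la)].

(* The column lengths of la viewed inside a rectangle with c columns: the
   columns to the right of the Ferrers diagram are present, with length 0
   (an even length, so they matter for [off_parity r] only if r is odd). *)
Definition box_columns (c : nat) (la : seq nat) : seq nat :=
  columns la ++ nseq (c - head 0 la) 0.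

Definition off_parity (r : nat) (s : seq nat) : nat :=
  count (fun l => odd l != odd r) s.

(* Main.v *)
From HB Require Import structures.
Require Import Defs.
From mathcomp Require Import all_boot all_order all_algebra all_fingroup.
From mathcomp Require Import ring zify.
From mathcomp.multinomials Require Import mpoly.
Set Implicit Arguments.
Unset Strict Implicit.
Unset Printing Implicit Defensive.
Import Order.TTheory GRing.Theory Num.Theory.

(** Cut a plane partition [a] of the trapezoid along its diagonals and record, for
    the diagonal at distance d from the main one, the lengths of the columns of
    the partition that its entries form. The defining inequalities say that from
    each diagonal to the next every column keeps its length or loses one cell,
    and the shape of the trapezoid bounds the lengths on the diagonal at distance
    d by (N - d) / 2, rounded up ([sum_plane_partitions]). So the plane partitions
    with a given main diagonal are families of c noncrossing lattice paths next
    to a wall, that is, symplectic tableaux. Their number is a determinant of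
    coefficients of (1 + X)^N times fixed polynomials, because this determinant
    obeys the same recursion in N ([chains_det]).

    It remains to sum this determinant over the main diagonals with exactly p
    columns of parity different from r. In terms of representations, the summands are
    the dimensions of the constituents of the restriction to the symplectic group
    (Proctor's odd symplectic group if N is odd) of the irreducible representation
    of GL_N whose diagram has c - p columns of length r and p columns of length
    r - 1, and the proof follows the classical one for this branching. Introduce
    one variable x_i for each of the c columns. The determinants are obtained by
    extracting coefficients from D times a monomial, where D is the Weyl
    denominator of type C, which factors as
      D = V * P, with V = prod_(i < j) (x_i - x_j)
                 and  P = prod_(i <= j) (1 - x_i x_j).
    Passing to complements in the rectangle, the sum over diagonals replaces the
    monomial by the sum of the alternants of all partitions with exactly p odd
    parts. By Pieri's rule this is the elementary symmetric polynomial e_p times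
    the sum over the partitions with even parts, and by Littlewood's identity the
    latter is the Vandermonde alternant divided by P ([littlewood_even]). Thus P
    cancels, and a single determinant of binomial coefficients is left
    ([symplectic_sum], [sum_sp_det]).

    That determinant reduces to a Vandermonde determinant and gives the product
    formula ([gl_det_formula]); summing over p with the Chu-Vandermonde identity
    gives the total number ([sum_gl_formula]). The description by alternating sums
    holds because each column of the diagonal partition contributes an alternating
    sum of as many signs as it has cells, and this depends on the parity of its
    length only ([off_parity_columns]). *)

(** * Plane partitions as families of column lengths *)

Lemma card_ltn n m : m <= n -> #|[pred j : 'I_n | j < m]| = m.
Proof.
move=> mn; rewrite -sum1_card -(big_ord_widen_cond n xpredT (fun=> 1)) //.
by rewrite sum1_card card_ord.
Qed.

(** Column lengths of a Ferrers diagram are cardinals of initial segments; this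
    turns statements about them into statements about single cells. *)
Lemma ltn_card_init n (p : pred 'I_n) :
  (forall i j : 'I_n, i <= j -> p j -> p i) -> forall i : 'I_n, (i < #|p|) = p i.
Proof.
move=> h i; case pi : (p i).
  rewrite -(card_ltn (ltn_ord i)); apply: subset_leq_card; apply/subsetP => j.
  by rewrite !inE ltnS => ji; apply: h pi.
apply/negbTE; rewrite -leqNgt -(card_ltn (ltnW (ltn_ord i))).
apply: subset_leq_card; apply/subsetP => j; rewrite !inE => pj.
by rewrite ltnNge; apply/negP => ij; move: pi; rewrite (h _ _ ij).
Qed.

Lemma leq_of_ltn m n : (forall i, i < m -> i < n) -> m <= n.
Proof. by move=> h; case: (leqP m n) => // /h; rewrite ltnn. Qed.

Lemma ord_chain T (le : rel T) n (f : 'I_n -> T) :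
  reflexive le -> transitive le ->
  (forall i j : 'I_n, j = i.+1 :> nat -> le (f i) (f j)) ->
  forall i j : 'I_n, (i <= j)%N -> le (f i) (f j).
Proof.
move=> lexx letr h i [j jn]; elim: j jn => [|j IH] jn.
  rewrite leqn0 => i0; suff -> : i = Ordinal jn by [].
  by apply/val_inj/eqP.
rewrite leq_eqVlt => /orP[/eqP e|].
  by suff -> : i = Ordinal jn by []; apply: val_inj.
rewrite ltnS => ij; have jn' : (j < n)%N by rewrite ltnW.
exact: letr (IH jn' ij) (h (Ordinal jn') (Ordinal jn) erefl).
Qed.

Definition noninc c (r : nat) (v : {ffun 'I_c -> 'I_r.+1}) : bool :=
  [forall i : 'I_c, forall j : 'I_c, (i <= j)%N ==> (v j <= v i)%N].

Lemma nonincP c r (v : {ffun 'I_c -> 'I_r.+1}) :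
  reflect (forall i j : 'I_c, (i <= j)%N -> (v j <= v i)%N) (noninc v).
Proof.
apply: (iffP forallP) => [h i j ij|h i].
  by have /forallP/(_ j)/implyP := h i; apply.
by apply/forallP=> j; apply/implyP; apply: h.
Qed.

(** The diagonal with t diagonals from it to the right end of the trapezoid,
    itself included, has at most [uphalf t] cells; t = 0 is the empty diagonal
    just beyond the right end. *)
Definition admissible t c r (v : {ffun 'I_c -> 'I_r.+1}) : bool :=
  noninc v && [forall i, v i <= uphalf t]%N.

Definition vstrip c r (v u : {ffun 'I_c -> 'I_r.+1}) : bool :=
  [forall i, (u i <= v i <= (u i).+1)%N].

(** The number of ways to fill the last t diagonals when the leftmost of them
    has column lengths [v]: the value at 1 of a symplectic character, counted
    by Gelfand-Tsetlin patterns read by columns. *)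
Fixpoint chains t c r (v : {ffun 'I_c -> 'I_r.+1}) : nat :=
  if admissible t v then
    if t is t'.+1 then (\sum_(u | vstrip v u) chains t' u)%N else 1%N
  else 0%N.

(** Extending a filling by 0 to the whole quadrant keeps the two monotonicity
    conditions between consecutive diagonals true without side conditions. *)
Definition entry (N r c : nat) (a : filling N r c) (i k : nat) : nat :=
  if [pick x : cell N r | ((val x).1 == i :> nat) && ((val x).2 == k :> nat)] is Some x
  then a x else 0.

Lemma entryE N r c (a : filling N r c) (x : cell N r) :
  entry a (val x).1 (val x).2 = a x.
Proof.
rewrite /entry; case: pickP => [y /andP[/eqP e1 /eqP e2]|/(_ x)]; last by rewrite !eqxx.
congr (nat_of_ord (a _)); apply: val_inj; case: (val y) (val x) e1 e2 => [? ?] [? ?] /= e1 e2.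
by congr pair; apply: val_inj.
Qed.

Lemma cell_exists N r i k : i < r -> i <= k -> k < N - i ->
  exists x : cell N r, (val x).1 = i :> nat /\ (val x).2 = k :> nat.
Proof.
move=> ir ik kN.
have iN : i < N by lia.
have kN' : k < N by lia.
have xP : in_trapezoid r (Ordinal iN, Ordinal kN') by rewrite /in_trapezoid /= ir ik.
by exists (exist (fun x => is_true (in_trapezoid r x)) _ xP).
Qed.

Lemma entry_out N r c (a : filling N r c) i k :
  ~~ [&& i < r, i <= k & k < N - i] -> entry a i k = 0.
Proof.
rewrite /entry; case: pickP => [x /andP[/eqP <- /eqP <-]|//].
by have := valP x; rewrite /in_trapezoid => ->.
Qed.

Lemma entry_le N r c (a : filling N r c) i k : entry a i k <= c.
Proof. by rewrite /entry; case: pickP => // x _; rewrite -ltnS ltn_ord. Qed.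

Lemma entry_antitone N r c (a : filling N r c) : plane_partition a ->
  forall i i' k k', i <= i' -> k <= k' -> i = i' \/ k = k' ->
  [&& i < r, i <= k & k < N - i] -> entry a i' k' <= entry a i k.
Proof.
move=> /forallP pp i i' k k' ii kk e /and3P[ir ik kN].
have [x [x1 x2]] := cell_exists ir ik kN.
case: (boolP [&& i' < r, i' <= k' & k' < N - i']); last by move/entry_out->.
case/and3P=> ir' ik' kN'; have [y [y1 y2]] := cell_exists ir' ik' kN'.
rewrite -x1 -x2 -y1 -y2 !entryE; have /forallP/(_ y)/implyP := pp x; apply.
by rewrite -!val_eqE /= x1 x2 y1 y2 ii kk; case: e => ->; rewrite eqxx ?orbT.
Qed.

Lemma entry_row N r c (a : filling N r c) i d : plane_partition a ->
  entry a i (i + d.+1) <= entry a i (i + d).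
Proof.
move=> pp; case: (boolP [&& i < r, i <= i + d & i + d < N - i]) => h.
  by apply: entry_antitone => //; [rewrite leq_add2l | left].
rewrite entry_out //; apply: contra h => /and3P[-> _ h]; rewrite leq_addr; lia.
Qed.

Lemma entry_col N r c (a : filling N r c) i d : plane_partition a ->
  entry a i.+1 (i.+1 + d) <= entry a i (i + d.+1).
Proof.
move=> pp; case: (boolP [&& i < r, i <= i + d.+1 & i + d.+1 < N - i]) => h.
  by apply: entry_antitone => //; [rewrite addnS | right; rewrite addnS].
rewrite entry_out //; apply: contra h => /and3P[h1 h2 h3]; lia.
Qed.

Lemma entry_diag N r c (a : filling N r c) i j d : plane_partition a -> i <= j ->
  entry a j (j + d) <= entry a i (i + d).
Proof.
move=> pp /subnKC <-; elim: (j - i) => [|m IH]; first by rewrite addn0.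
apply: leq_trans IH; rewrite addnS.
exact: leq_trans (entry_col _ _ pp) (entry_row _ _ pp).
Qed.

Definition fcons (T : Type) n (a : T) (g : {ffun 'I_n -> T}) : {ffun 'I_n.+1 -> T} :=
  [ffun i => if unlift ord0 i is Some j then g j else a].

Lemma fcons0 (T : Type) n (a : T) (g : {ffun 'I_n -> T}) : fcons a g ord0 = a.
Proof. by rewrite ffunE unlift_none. Qed.

Lemma fconsS (T : Type) n (a : T) (g : {ffun 'I_n -> T}) i :
  fcons a g (lift ord0 i) = g i.
Proof. by rewrite ffunE liftK. Qed.

Lemma fcons_eta (T : Type) n (f : {ffun 'I_n.+1 -> T}) :
  fcons (f ord0) [ffun i => f (lift ord0 i)] = f.
Proof.
apply/ffunP=> i; case: (unliftP ord0 i) => [j|] ->.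
  by rewrite fconsS ffunE.
by rewrite fcons0.
Qed.

Lemma big_fcons (R : Type) (idx : R) (op : Monoid.com_law idx) (T : finType) n
    (P : pred {ffun 'I_n.+1 -> T}) (F : {ffun 'I_n.+1 -> T} -> R) :
  \big[op/idx]_(f | P f) F f =
  \big[op/idx]_(a : T) \big[op/idx]_(g : {ffun 'I_n -> T} | P (fcons a g)) F (fcons a g).
Proof.
rewrite pair_big_dep /=.
rewrite (reindex (fun p : T * {ffun 'I_n -> T} => fcons p.1 p.2)) //=.
exists (fun f => (f ord0, [ffun i => f (lift ord0 i)])) => [[a g] _|f _] /=.
  by rewrite fcons0; congr pair; apply/ffunP=> i; rewrite ffunE fconsS.
exact: fcons_eta.
Qed.

Lemma sumn_fcons (T : finType) n (P : pred {ffun 'I_n.+1 -> T}) (F : {ffun 'I_n.+1 -> T} -> nat) :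
  \sum_(f | P f) F f =
  \sum_(a : T) \sum_(g : {ffun 'I_n -> T} | P (fcons a g)) F (fcons a g).
Proof. exact: big_fcons. Qed.

(** Index d is the distance to the main diagonal, so [n ord0] describes the main
    diagonal and [n ord_max] the empty one. *)
Definition valid_family t c r (n : {ffun 'I_t.+1 -> {ffun 'I_c -> 'I_r.+1}}) : bool :=
  [forall d : 'I_t.+1, admissible (t - d) (n d)] &&
  [forall d : 'I_t.+1, forall d' : 'I_t.+1, (d' == d.+1 :> nat) ==> vstrip (n d) (n d')].

Lemma valid_family_fcons t c r (v : {ffun 'I_c -> 'I_r.+1}) n :
  @valid_family t.+1 c r (fcons v n) =
  [&& admissible t.+1 v, vstrip v (n ord0) & valid_family n].
Proof.
apply/andP/and3P => [[/forallP h1 /forallP h2]|[h1 h2 /andP[/forallP h3 /forallP h4]]].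
  split; first by have := h1 ord0; rewrite fcons0.
    by have /forallP/(_ (lift ord0 ord0)) := h2 ord0; rewrite fcons0 fconsS.
  apply/andP; split; apply/forallP => d.
    by have := h1 (lift ord0 d); rewrite fconsS /= /bump /= subSS.
  apply/forallP => d'; have /forallP/(_ (lift ord0 d')) := h2 (lift ord0 d).
  by rewrite !fconsS.
split; apply/forallP => d.
  case: (unliftP ord0 d) => [d' ->|->]; rewrite ?fcons0 ?fconsS //.
  by rewrite /= /bump /= subSS.
apply/forallP => d'; case: (unliftP ord0 d') => [e' ->|->]; last by apply/implyP.
case: (unliftP ord0 d) => [e ->|->]; rewrite ?fcons0 ?fconsS.
  by have /forallP/(_ e') := h4 e.
by apply/implyP => /eqP [e0]; suff -> : e' = ord0 by []; apply: val_inj.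
Qed.

(** A family is its first diagonal followed by a family one step shorter, which
    is the recursion that defines [chains]. *)
Lemma count_valid_families t c r (v : {ffun 'I_c -> 'I_r.+1}) :
  \sum_(n : {ffun 'I_t.+1 -> {ffun 'I_c -> 'I_r.+1}} |
     valid_family n && (n ord0 == v)) 1 = chains t v.
Proof.
elim: t v => [|t IH] v.
  rewrite /= sumn_fcons (bigD1 v) //= [X in _ + X]big1 => [|u uv]; last first.
    by rewrite big1 // => g; rewrite fcons0 (negbTE uv) andbF.
  have g0 : {ffun 'I_0 -> {ffun 'I_c -> 'I_r.+1}} by apply: finfun => -[].
  have ge g : g = g0 by apply/ffunP => -[].
  have ve : valid_family (fcons v g0) = admissible 0 v.
    apply/andP/idP => [[/forallP/(_ ord0)]|av]; first by rewrite fcons0.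
    by split; apply/forallP => d; [|apply/forallP => d']; rewrite !ord1 ?fcons0.
  rewrite addn0; case: ifP => av.
    by rewrite (big_pred1 g0) // => g; rewrite (ge g) /= ve fcons0 !eqxx av.
  by rewrite big_pred0 // => g; rewrite (ge g) ve av.
rewrite sumn_fcons (bigD1 v) //= [X in _ + X]big1 => [|u uv]; last first.
  by rewrite big1 // => g; rewrite fcons0 (negbTE uv) andbF.
rewrite addn0; under eq_bigl => g do rewrite fcons0 eqxx andbT valid_family_fcons.
case: ifP => av; last by rewrite big_pred0.
under eq_bigl => g do rewrite andTb.
rewrite (partition_big (fun g : {ffun 'I_t.+1 -> {ffun 'I_c -> 'I_r.+1}} => g ord0) (fun u => vstrip v u)) /= => [|g /andP[]//].
apply: eq_bigr => u vu; rewrite -IH; apply: eq_bigl => g.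
by case: eqP => [->|]; rewrite ?andbF // vu.
Qed.

(** Column j of the d-th diagonal counts the entries exceeding j; by conjugation
    the entry in row i is recovered as the number of columns longer than i. *)
Definition to_family N r c (a : filling N r c) :
    {ffun 'I_N.+1 -> {ffun 'I_c -> 'I_r.+1}} :=
  [ffun d : 'I_N.+1 => [ffun j : 'I_c => inord #|[pred i : 'I_r | j < entry a i (i + d)]|]].

Definition of_family N r c (n : {ffun 'I_N.+1 -> {ffun 'I_c -> 'I_r.+1}}) : filling N r c :=
  [ffun x : cell N r =>
     inord #|[pred j : 'I_c | (val x).1 < n (inord ((val x).2 - (val x).1)) j]|].

Lemma to_familyE N r c (a : filling N r c) d j :
  to_family a d j = #|[pred i : 'I_r | j < entry a i (i + d)]| :> nat.
Proof. by rewrite !ffunE inordK // ltnS -[X in _ <= X]card_ord max_card. Qed.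

Lemma ltn_to_family N r c (a : filling N r c) d j (i : nat) : plane_partition a ->
  (i < to_family a d j) = (i < r) && (j < entry a i (i + d)).
Proof.
move=> pp; case: (ltnP i r) => ir /=; last first.
  by apply/negbTE; rewrite -leqNgt (leq_trans _ ir) // -ltnS.
rewrite to_familyE -[i]/(val (Ordinal ir)) ltn_card_init // => i1 i2 i12 /=.
by move=> h; apply: leq_trans h _; apply: entry_diag.
Qed.

(** The row inequality between consecutive diagonals says that columns do not
    grow with d, the column inequality that they shrink by at most one. *)
Lemma valid_to_family N r c (a : filling N r c) :
  plane_partition a -> valid_family (to_family a).
Proof.
move=> pp; apply/andP; split; apply/forallP => d.
  apply/andP; split.
    apply/nonincP => j j' jj; apply: leq_of_ltn => i.
    by rewrite !ltn_to_family // => /andP[-> h]; apply: leq_ltn_trans h.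
  apply/forallP => j; rewrite leqNgt ltn_to_family //; apply/negP => /andP[_].
  by rewrite entry_out //; apply/negP => /and3P[_ _]; lia.
apply/forallP => d'; apply/implyP => /eqP dd; apply/forallP => j; apply/andP; split.
  apply: leq_of_ltn => i; rewrite !ltn_to_family // dd => /andP[-> h].
  exact: leq_trans h (entry_row _ _ pp).
apply: leq_of_ltn => -[//|i]; rewrite ltnS !ltn_to_family // dd => /andP[ir h].
by rewrite (ltnW ir); apply: leq_trans h (entry_col _ _ pp).
Qed.

Lemma to_familyK N r c (a : filling N r c) :
  plane_partition a -> of_family (to_family a) = a.
Proof.
move=> pp; apply/ffunP => x; apply: val_inj; rewrite /= ffunE.
have /and3P[ir ik kN] := valP x.
rewrite inordK; last by rewrite ltnS -[X in _ <= X]card_ord max_card.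
rewrite -[RHS](@card_ltn c); last by rewrite -ltnS.
apply: eq_card => j; rewrite !inE ltn_to_family // ir inordK.
  by rewrite subnKC // entryE.
by rewrite ltnS (leq_trans (leq_subr _ _)) // ltnW.
Qed.

Lemma family_leq N r c (n : {ffun 'I_N.+1 -> {ffun 'I_c -> 'I_r.+1}}) (d d' : 'I_N.+1) j :
  valid_family n -> d <= d' -> n d' j <= n d j.
Proof.
case/andP => _ /forallP v2.
apply: (@ord_chain _ geq N.+1 (fun d => n d j : nat)); first exact: leqnn.
  by move=> x y z xy yz; apply: leq_trans yz xy.
move=> {}d {}d' dd; have /forallP/(_ d')/implyP := v2 d.
by rewrite dd eqxx => /(_ isT)/forallP/(_ j)/andP[].
Qed.

(** Columns shrink by at most one per diagonal; this becomes the inequality of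
    plane partitions down a column of the trapezoid. *)
Lemma family_drop N r c (n : {ffun 'I_N.+1 -> {ffun 'I_c -> 'I_r.+1}}) (d d' : 'I_N.+1) j :
  valid_family n -> d <= d' -> n d j + d <= n d' j + d'.
Proof.
case/andP => _ /forallP v2.
apply: (@ord_chain _ leq N.+1 (fun d => n d j + d)); first exact: leqnn.
  exact: leq_trans.
move=> {}d {}d' dd; have /forallP/(_ d')/implyP := v2 d.
rewrite dd eqxx => /(_ isT)/forallP/(_ j)/andP[_]; lia.
Qed.

Lemma ltn_of_family N r c (n : {ffun 'I_N.+1 -> {ffun 'I_c -> 'I_r.+1}})
    (x : cell N r) (j : 'I_c) : valid_family n ->
  (j < of_family n x) = ((val x).1 < n (inord ((val x).2 - (val x).1)) j).
Proof.
move=> vn; rewrite ffunE inordK; last by rewrite ltnS -[X in _ <= X]card_ord max_card.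
rewrite (@ltn_card_init c) // => i i' ii /= h; apply: leq_trans h _.
by case/andP: vn => /forallP/(_ (inord ((val x).2 - (val x).1)))/andP[/nonincP v1 _] _; apply: v1.
Qed.

Lemma plane_partition_of_family N r c (n : {ffun 'I_N.+1 -> {ffun 'I_c -> 'I_r.+1}}) :
  valid_family n -> plane_partition (of_family n).
Proof.
move=> vn; apply/forallP => x; apply/forallP => y; apply/implyP => xy.
apply: leq_of_ltn => j jy.
have jc : j < c by apply: leq_trans jy _; rewrite -ltnS.
move: jy; rewrite -[j]/(val (Ordinal jc)) !ltn_of_family //.
have /and3P[_ x1 x2] := valP x; have /and3P[_ y1 y2] := valP y.
have dN (z : cell N r) : (val z).2 - (val z).1 < N.+1.
  by rewrite ltnS (leq_trans (leq_subr _ _)) // ltnW.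
case/orP: xy => /andP[/eqP e le] h.
  rewrite e; apply: leq_trans h (family_leq _ vn _).
  by rewrite !inordK ?leq_sub2r // -e; apply: dN.
have := @family_drop _ _ _ n (inord ((val y).2 - (val y).1)) (inord ((val x).2 - (val x).1)) (Ordinal jc) vn.
rewrite !inordK // e leq_sub2l // => /(_ isT).
have shift (p q u v k : nat) :
  p <= q -> q <= k -> q < u -> u + (k - q) <= v + (k - p) -> p < v by lia.
exact: shift le y1 h.
Qed.

(** The bound in [admissible] says that a column on diagonal d only reaches rows
    i whose cell on that diagonal lies in the trapezoid, so [of_family] loses
    nothing. *)
Lemma of_familyK N r c (n : {ffun 'I_N.+1 -> {ffun 'I_c -> 'I_r.+1}}) :
  valid_family n -> to_family (of_family n) = n.
Proof.
move=> vn; have pp := plane_partition_of_family vn.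
apply/ffunP => d; apply/ffunP => j; apply: val_inj; apply/eqP.
rewrite eqn_leq; apply/andP; split; apply: leq_of_ltn => i; rewrite ltn_to_family //.
  case/andP => ir.
  case: (boolP [&& i < r, i <= i + d & i + d < N - i]) => [|/entry_out -> //].
  case/and3P => _ ik kN; have [x [x1 x2]] := cell_exists ir ik kN.
  rewrite -{1}x1 -x2 entryE ltn_of_family // x1 x2.
  by have -> : inord (i + d - i) = d by apply: val_inj; rewrite /= addKn inord_val.
move=> h; have ir : i < r by apply: leq_trans h _; exact: (ltn_ord (n d j)).
have kN : i + d < N - i.
  case/andP: vn => /forallP/(_ d)/andP[_ /forallP/(_ j)] v1 _.
  have h2 : i < uphalf (N - d) := leq_trans h v1; lia.
have [x [x1 x2]] := cell_exists ir (leq_addr d i) kN.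
rewrite ir -{1}x1 -x2 entryE ltn_of_family // x1 x2.
by have -> : inord (i + d - i) = d by apply: val_inj; rewrite /= addKn inord_val.
Qed.

Lemma sum_plane_partitions N r c (Q : pred {ffun 'I_c -> 'I_r.+1}) :
  #|[set a : filling N r c | plane_partition a && Q (to_family a ord0)]| =
  \sum_(v | Q v) chains N v.
Proof.
transitivity (\sum_(n : {ffun 'I_N.+1 -> {ffun 'I_c -> 'I_r.+1}} |
     valid_family n && Q (n ord0)) 1).
  rewrite (reindex_onto (@to_family N r c) (@of_family N r c)) => [|n /andP[vn _]].
    rewrite sum1_card; apply: eq_card => a; rewrite !inE unfold_in /=.
    case pp : (plane_partition a); first by rewrite valid_to_family // to_familyK // eqxx andbT.
    apply/esym/negbTE; apply: contraFN pp => /andP[/andP[va _] /eqP <-].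
    exact: plane_partition_of_family.
  exact: of_familyK vn.
rewrite (partition_big (fun n : {ffun 'I_N.+1 -> {ffun 'I_c -> 'I_r.+1}} => n ord0) Q) /= => [|n /andP[]//].
apply: eq_bigr => v Qv; rewrite -count_valid_families; apply: eq_bigl => n.
by case: eqP => [->|]; rewrite ?andbF // Qv !andbT.
Qed.

Local Open Scope ring_scope.

(** * Determinant for the number of chains *)

(** With [D = det (sp_col n j evaluated at x_i)] one gets, up to a monomial, the
    Weyl denominator of type C; the columns are chosen so that [D] factors as a
    homogeneous Vandermonde determinant. *)
Definition sp_col c j : {poly rat} :=
  'X^(c.-1 - j) * ((1 - 'X^2) * (1 + 'X^2) ^+ j).

Definition sp_row t c k j : rat := ((1 + 'X) ^+ t * sp_col c j)`_k.

Definition sp_det t c (v : 'I_c -> nat) : rat :=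
  \det (\matrix_(i, j < c) sp_row t c (v i + (c.-1 - i)) j).

Definition palindromic (R : nzRingType) (d : nat) (q : {poly R}) : Prop :=
  (forall a b, (a + b)%N = d -> q`_a = q`_b) /\ (forall k, (d < k)%N -> q`_k = 0).

Lemma palindromic1 (R : nzRingType) : palindromic 0 (1 : {poly R}).
Proof.
split=> [a b /eqP|k k0]; first by rewrite addn_eq0 => /andP[/eqP-> /eqP->].
by rewrite coef1 gtn_eqF.
Qed.

Lemma palindromic_mul1Xn (R : nzRingType) e d (q : {poly R}) :
  palindromic d q -> palindromic (d + e) ((1 + 'X^e) * q).
Proof.
move=> [qs q0]; split=> [a b ab|k dk]; rewrite mulrDl mul1r !coefD !coefXnM; last first.
  by rewrite q0 ?add0r; [case: ltnP => // ek; apply: q0|]; lia.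
wlog ab' : a b ab / (a <= b)%N.
  by move=> H; case: (leqP a b) => h; [|symmetry]; apply: H; lia.
case: (ltnP a e) => ae; last first.
  rewrite (ltnNge b) (leq_trans ae) //= (qs a (b - e)%N); last lia.
  by rewrite (qs b (a - e)%N) 1?addrC //; lia.
rewrite addr0 (q0 b) ?add0r; last lia.
case: ltnP => be; first by rewrite q0 //; lia.
by apply: qs; lia.
Qed.

Lemma coef_antipalindromic (R : nzRingType) m (q : {poly R}) : palindromic m.*2 q -> ((1 - 'X^2) * q)`_m.+1 = 0.
Proof.
move=> [qs q0]; rewrite mulrBl mul1r coefB coefXnM.
case: ltnP => h; first by rewrite q0 ?subr0 //; lia.
by rewrite (qs m.+1 (m.+1 - 2)%N) ?subrr //; lia.
Qed.

(** The wall: the polynomial is antipalindromic about the degree q + c, hence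
    its middle coefficient vanishes. *)
Lemma sp_wall c q j : (j < c)%N -> ((1 + 'X) ^+ q.*2 * sp_col c j)`_(q.+1 + c.-1) = 0.
Proof.
move=> jc; rewrite /sp_col mulrCA coefXnM ltnNge (_ : (_ <= _)%N); last lia.
rewrite (_ : q.+1 + c.-1 - (c.-1 - j) = (q + j).+1)%N /=; last lia.
rewrite mulrCA; apply: coef_antipalindromic; rewrite doubleD.
rewrite -[j.*2]muln2 -[q.*2]mul1n -muln2 mul1n mulrC.
have {jc} : palindromic q.*2 ((1 + 'X : {poly rat}) ^+ q.*2).
  elim: (q.*2) => [|k IH]; first exact: palindromic1.
  by rewrite exprS -addn1 -['X]expr1; apply: palindromic_mul1Xn; rewrite expr1.
elim: j => [|j IH] h; first by rewrite mul1r addn0 muln2.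
rewrite exprS -mulrA mulSn addnCA addnC; apply: palindromic_mul1Xn; exact: IH.
Qed.

Lemma det_add_rows (R : comNzRingType) n (M : bool -> 'M[R]_n) :
  \det (M false + M true) =
  \sum_(f : {ffun 'I_n -> bool}) \det (\matrix_(i, j) M (f i) i j).
Proof.
rewrite /determinant exchange_big; apply: eq_bigr => s _ /=.
rewrite -mulr_sumr; congr (_ * _).
transitivity (\prod_i \sum_(b : bool) M b i (s i)).
  by apply: eq_bigr => i _; rewrite big_bool mxE addrC.
rewrite bigA_distr_bigA; apply: eq_bigr => f _.
by apply: eq_bigr => i _; rewrite mxE.
Qed.

Lemma sp_det0 c r (v : {ffun 'I_c -> 'I_r.+1}) : admissible 0 v -> sp_det 0 (fun i => v i) = 1.
Proof.
case/andP=> _ /forallP v0; rewrite /sp_det -det_tr det_trig.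
  rewrite big1 // => i _; rewrite !mxE /sp_row mul1r.
  have /eqP -> : v i == 0%N :> nat by rewrite -leqn0; apply: v0.
  rewrite add0n /sp_col coefXnM ltnn subnn -horner_coef0.
  rewrite !(hornerM, horner_exp, hornerD, hornerN, hornerXn, hornerC).
  by rewrite !hornerX mulr0 subr0 mul1r -[RHS](expr1n _ i); congr (_ ^+ _); ring.
apply/is_trig_mxP => i j ij; rewrite !mxE /sp_row mul1r.
have /eqP -> : v j == 0%N :> nat by rewrite -leqn0; apply: v0.
by rewrite add0n /sp_col coefXnM ifT //; have := ltn_ord j; lia.
Qed.

(** Multiplying by 1 + X adds to each row the row with index one less, and the
    determinant is multilinear: each subset of columns may shrink by one. *)
Lemma sp_detS t c (v : 'I_c -> nat) :
  sp_det t.+1 v = \sum_(f : {ffun 'I_c -> bool})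
     \det (\matrix_(i, j < c) ('X^(f i) * ((1 + 'X) ^+ t * sp_col c j))`_(v i + (c.-1 - i))).
Proof.
transitivity (\det
  ((\matrix_(i, j < c) ('X^(false) * ((1 + 'X) ^+ t * sp_col c j))`_(v i + (c.-1 - i))) +
  (\matrix_(i, j < c) ('X^(true) * ((1 + 'X) ^+ t * sp_col c j))`_(v i + (c.-1 - i))))).
  congr (\det _); apply/matrixP=> i j; rewrite !mxE /sp_row -coefD -mulrDl.
  by rewrite exprS mulrA.
rewrite (det_add_rows (fun b : bool => \matrix_(i, j < c)
   ('X^b * ((1 + 'X) ^+ t * sp_col c j))`_(v i + (c.-1 - i)))).
by apply: eq_bigr => f _; congr (\det _); apply/matrixP=> i j; rewrite !mxE.
Qed.

(** Both sides satisfy the same recursion: in [sp_detS] the choices of shrinking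
    columns that do not lead to an admissible diagonal contribute 0. If two
    consecutive columns get out of order, two rows coincide; a column of negative
    length gives a zero row; and exceeding the bound on the length of the
    diagonal is excluded by [sp_wall]. *)
Lemma chains_det t c r (v : {ffun 'I_c -> 'I_r.+1}) :
  admissible t v -> (chains t v)%:R = sp_det t (fun i => v i).
Proof.
elim: t v => [|t IH] v av; first by rewrite /= av sp_det0.
rewrite [chains _ _]/= av natr_sum sp_detS.
have [/nonincP vd /forallP vb] := andP av.
pose psi (f : {ffun 'I_c -> bool}) : {ffun 'I_c -> 'I_r.+1} :=
  [ffun i => inord (v i - f i)].
pose phi (u : {ffun 'I_c -> 'I_r.+1}) : {ffun 'I_c -> bool} :=
  [ffun i => (u i < v i)%N].
have psiE f i : psi f i = (v i - f i)%N :> nat.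
  by rewrite ffunE inordK // ltnS (leq_trans (leq_subr _ _)) // -ltnS.
pose good (f : {ffun 'I_c -> bool}) := [forall i, (f i <= v i)%N] && admissible t (psi f).
pose term (f : {ffun 'I_c -> bool}) := \det (\matrix_(i, j < c)
  ('X^(f i) * ((1 + 'X) ^+ t * sp_col c j))`_(v i + (c.-1 - i))).
rewrite (bigID good) /= [X in _ + X]big1 ?addr0 => [|f ngf].
  rewrite (reindex_onto phi psi) => [|f /andP[/forallP fv _]]; last first.
    apply/ffunP=> i; have := fv i; rewrite [LHS]ffunE psiE.
    by case: (f i); case: (val (v i)) => //= n; lia.
  rewrite (bigID (fun u => admissible t u)) /= addrC big1 ?add0r => [|u /andP[_ /negbTE nu]].
    apply: eq_big => [u|u /andP[uv au]].
      have vE : vstrip v u = [forall i, (phi u i <= v i)%N] && (psi (phi u) == u).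
        apply/forallP/andP => [h|[/forallP h1 /eqP h2] i].
          split; first by apply/forallP => i; rewrite ffunE; have := h i; lia.
          apply/eqP/ffunP => i; apply: val_inj; rewrite /= psiE ffunE.
          by have := h i; lia.
        by have := psiE (phi u) i; rewrite h2 ffunE; lia.
      rewrite vE /good; case: (psi (phi u) =P u) => [->|]; rewrite ?andbF ?andbT //.
    rewrite IH // /sp_det; congr (\det _); apply/matrixP=> i j; rewrite !mxE ffunE.
    rewrite coefXnM; have := forallP uv i; have [h1|h1] := boolP (u i < v i)%N => /= h2.
      rewrite ifF /sp_row; last lia.
      by congr (_`_ _); lia.
    by rewrite subn0 /sp_row; congr (_`_ _); lia.
    by suff -> : chains t u = 0%N by []; clear -nu; case: t nu => [|t] nu; rewrite /= nu.
(* Columns of equal length, of which only the left one shrinks: equal rows. *)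
have [/existsP[i /existsP[j /and4P[/eqP ij /eqP vij fi fj]]]|nc] :=
  boolP [exists i : 'I_c, exists j : 'I_c,
     [&& (j == i.+1 :> nat), (v i == v j :> nat), f i & ~~ f j]].
  have ne : i != j by rewrite -val_eqE /= ij; lia.
  apply: (determinant_alternate ne) => l; rewrite !mxE fi (negbTE fj) !coefXnM.
  rewrite ltn0 ifF; last by have := ltn_ord j; lia.
  by congr (_`_ _); have := ltn_ord j; lia.
have nc' (i j : 'I_c) : j = i.+1 :> nat -> v i = v j :> nat -> f i -> f j.
  move=> ij vij fi; have /existsPn/(_ i)/existsPn/(_ j) := nc.
  by rewrite ij vij !eqxx fi negbK.
(* An empty column that shrinks forces the last one to do so: a zero row. *)
have [fv|/forallPn[i]] := boolP [forall i, (f i <= v i)%N]; last first.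
  have fvi : ~~ (f i <= v i)%N -> (v i = 0 :> nat)%N /\ f i.
    by case: (f i); case: (val (v i)).
  move=> /fvi[vi fi].
  have c0 : (c.-1 < c)%N by have := ltn_ord i; lia.
  pose l := Ordinal c0.
  have [vl fl] : v l = 0%N :> nat /\ f l.
    have il : (i <= l)%N by have := ltn_ord i; rewrite /=; lia.
    have vl (j : 'I_c) : (i <= j)%N -> v j = 0%N :> nat.
      by move=> /vd; rewrite vi leqn0 => /eqP.
    split; first exact: vl.
    have := @ord_chain _ implb c (fun j : 'I_c => (i <= j)%N && f j).
    move=> /(_ _ _ _ i l il); rewrite leqnn fi il; apply=> //; first by case.
      by case; case; case.
    move=> j k jk; apply/implyP => /andP[ij fj]; rewrite jk (leq_trans ij) //=.
    by apply: (nc' j k) => //; rewrite !vl // jk (leq_trans ij).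
  rewrite (expand_det_row _ l) big1 // => j _.
  by rewrite !mxE fl coefXnM vl /= subnn mul0r.
have fv' i : (f i <= v i)%N := forallP fv i.
(* Only the bound on the first column can fail now, and then t is even. *)
have ud : noninc (psi f).
  apply/nonincP => i j; apply: (@ord_chain _ geq c (fun i => psi f i : nat)) => {i j}.
  - exact: leqnn.
  - by move=> a b d ab bd; apply: leq_trans bd ab.
  move=> i j ij; rewrite /= !psiE.
  have vij : (v j <= v i)%N by apply: vd; rewrite ij.
  have := nc' i j ij; have := fv' i; have := fv' j.
  by case: (f i); case: (f j); rewrite ?subn0 //=; lia.
have : ~~ [forall i, psi f i <= uphalf t]%N.
  by move: ngf; rewrite /good fv /admissible ud.
move=> /forallPn[i]; rewrite psiE -ltnNge => ti.
have c0 : (0 < c)%N by have := ltn_ord i; lia.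
pose z := Ordinal c0.
have uz : (uphalf t < v z - f z)%N.
  rewrite -psiE (leq_trans ti) // -psiE; exact: (nonincP _ ud).
have vz : v z = (uphalf t).+1 :> nat by have := vb z; lia.
have fz : f z = false by move: uz; case: (f z) => //; lia.
have te : t = (uphalf t).*2.
  have := vb z; rewrite vz; lia.
rewrite (expand_det_row _ z) big1 // => j _.
rewrite !mxE fz mul1r vz subn0 {1}te sp_wall ?mul0r //.
Qed.

(** * Alternants and the Littlewood identity *)

(** The alternant whose quotient by [alt x (fun j => j)] is a Schur polynomial. *)
Definition alt (R : comNzRingType) n (x : 'I_n -> R) (b : 'I_n -> nat) : R :=
  \det (\matrix_(i, j) x i ^+ b j).

Lemma eq_alt (R : comNzRingType) n (x : 'I_n -> R) b b' :
  b =1 b' -> alt x b = alt x b'.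
Proof. by move=> e; congr (\det _); apply/matrixP=> i j; rewrite !mxE e. Qed.

Lemma alt_addn (R : comNzRingType) n (x : 'I_n -> R) b d :
  alt x (fun j => d + b j)%N = (\prod_i x i) ^+ d * alt x b.
Proof.
rewrite /alt.
have -> : \matrix_(i, j) x i ^+ (d + b j) =
    diag_mx (\row_i x i ^+ d) *m (\matrix_(i, j) x i ^+ b j).
  apply/matrixP=> i j; rewrite mul_diag_mx !mxE exprD //.
rewrite det_mulmx det_diag; congr (_ * _).
by rewrite -prodrXl; apply: eq_bigr => i _; rewrite mxE.
Qed.

Lemma alt_eq_exp (R : comNzRingType) n (x : 'I_n -> R) b (j1 j2 : 'I_n) :
  j1 != j2 -> b j1 = b j2 -> alt x b = 0.
Proof.
move=> ne e; rewrite /alt -det_tr.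
by apply: (determinant_alternate ne) => i; rewrite !mxE e.
Qed.

Lemma alt_expand0 (R : comNzRingType) n (x : 'I_n.+1 -> R) (h : 'I_n.+1 -> R) b :
  \det (\matrix_(i, j) if unlift ord0 j is Some j' then x i ^+ (b j').+1 else h i) =
  \sum_k h k * ((-1) ^+ k * (\prod_j x (lift k j) * alt (x \o lift k) b)).
Proof.
rewrite (expand_det_col _ ord0); apply: eq_bigr => k _.
rewrite !mxE unlift_none; congr (_ * _).
rewrite /cofactor addn0; congr (_ * _).
rewrite -[X in X * _]expr1 -alt_addn.
by congr (\det _); apply/matrixP=> i j; rewrite !mxE liftK.
Qed.

Lemma alt_rot (R : comNzRingType) n (x : 'I_n.+1 -> R) :
  alt x (fun j => if unlift ord0 j is Some j' then j' : nat else n) =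
  (-1) ^+ n * alt x (fun j => j).
Proof.
rewrite /alt (expand_det_col _ ord0) [in RHS](expand_det_col _ ord_max) mulr_sumr.
apply: eq_bigr => k _; rewrite !mxE unlift_none [RHS]mulrCA; congr (_ * _).
rewrite /cofactor addn0 mulrA -exprD addnCA exprD addnn -[(-1) ^+ n.*2]signr_odd odd_double mulr1.
congr (_ * \det _); apply/matrixP=> i j; rewrite !mxE liftK.
by rewrite /= /bump leqNgt ltn_ord.
Qed.

Lemma prod_1sub_coef (R : comNzRingType) n (x : 'I_n -> R) :
  (size (\prod_(j < n) (1 - x j *: 'X))%R <= n.+1)%N /\
  (\prod_(j < n) (1 - x j *: 'X))`_n = (-1) ^+ n * \prod_j x j.
Proof.
elim: n x => [|n IH] x; first by rewrite !big_ord0 size_poly1 coef1 mulr1.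
have [s c] := IH (fun j => x (widen_ord (leqnSn n) j)).
rewrite [\prod_(_ < _) (1 - _)]big_ord_recr [\prod_j x j]big_ord_recr /=.
rewrite mulrBr mulr1 -scalerAr; split.
  rewrite (leq_trans (size_polyD _ _)) // size_polyN geq_max (leq_trans s) //=.
  by rewrite (leq_trans (size_scale_leq _ _)) // (leq_trans (size_polyMleq _ _)) // size_polyX addn2 ltnS.
rewrite coefB coefZ coefMX /= c nth_default // exprS; ring.
Qed.

(** Lagrange interpolation at 0, with denominators cleared, of the polynomial
    [g = prod_j (1 - x_j X)] at the nodes x_k. The degree of g is one too large
    for interpolation to be exact, and the leading coefficient of g accounts for
    the term [(prod_i x_i) ^+ 2]. The determinant with first column [g (x_i)] is
    linear in g, and every power of X in between repeats a column. *)
Lemma alt_lagrange (R : comNzRingType) n (x : 'I_n.+1 -> R) :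
  \sum_k (\prod_j (1 - x k * x j)) *
         ((-1) ^+ k * (\prod_j x (lift k j) * alt (x \o lift k) (fun j => j))) =
  (1 - (\prod_i x i) ^+ 2) * alt x (fun j => j).
Proof.
pose G : {poly R} := \prod_(j < n.+1) (1 - x j *: 'X).
pose T (k : 'I_n.+1) : R :=
  ((-1) ^+ k * (\prod_j x (lift k j) * alt (x \o lift k) (fun j => j))).
have [szG GS] := prod_1sub_coef x.
have Gx k : \prod_j (1 - x k * x j) = \sum_(l < n.+2) G`_l * x k ^+ l.
  rewrite -horner_coef_wide // /G horner_prod; apply: eq_bigr => j _.
  by rewrite !hornerE mulrC.
have {Gx} -> : \sum_k (\prod_j (1 - x k * x j)) * T k =
   \sum_(l < n.+2) G`_l * \sum_k x k ^+ l * T k.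
  under eq_bigr => k _ do rewrite Gx mulr_suml.
  rewrite exchange_big /=; apply: eq_bigr => l _; rewrite mulr_sumr.
  by apply: eq_bigr => k _; rewrite !mulrA.
have Tl (l : nat) : \sum_(k < n.+1) x k ^+ l * T k =
   alt x (fun j => if unlift ord0 j is Some j' then j'.+1 else l).
  rewrite -(alt_expand0 x (fun k => x k ^+ l) (fun j => j)); congr (\det _).
  by apply/matrixP=> i j; rewrite !mxE; case: unliftP.
have G0 : G`_0 = 1.
  by rewrite -horner_coef0 horner_prod big1 // => j _; rewrite !hornerE ?mulr0 ?subr0.
clearbody T.
rewrite (eq_bigr (fun l : 'I_n.+2 => G`_l * alt x (fun j =>
  if unlift ord0 j is Some j' then j'.+1 else l))) => [|l _]; last first.
  by congr (_ * _); exact: Tl.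
rewrite big_ord_recl big_ord_recr /= big1 ?add0r => [|l _]; last first.
  rewrite (@alt_eq_exp _ _ _ _ ord0 (lift ord0 l)) ?mulr0 //.
  by rewrite unlift_none liftK.
rewrite G0 mul1r GS.
have -> : alt x (fun j => if unlift ord0 j is Some j' then j'.+1 else 0%N) =
    alt x (fun j => j).
  by apply: eq_alt => j; case: unliftP => [j'|] ->.
have -> : alt x (fun j => if unlift ord0 j is Some j' then j'.+1 else n.+1) =
    (\prod_i x i) * ((-1) ^+ n * alt x (fun j => j)).
  rewrite -alt_rot -[X in _ = X * _]expr1 -alt_addn.
  by apply: eq_alt => j; case: unliftP.
rewrite mulrBl mul1r; congr (_ + _).
have e : (-1 : R) ^+ n * (-1) ^+ n = 1 by rewrite -exprD -signr_odd oddD addbb.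
rewrite exprS /= /bump /=.
transitivity (- ((-1) ^+ n * (-1) ^+ n) * (\prod_i x i) ^+ 2 * alt x (fun j => j)).
  ring.
by rewrite e; ring.
Qed.

Lemma sum_fcons (V : nmodType) (T : finType) n
    (P : pred {ffun 'I_n.+1 -> T}) (F : {ffun 'I_n.+1 -> T} -> V) :
  \sum_(f | P f) F f =
  \sum_(a : T) \sum_(g : {ffun 'I_n -> T} | P (fcons a g)) F (fcons a g).
Proof. exact: big_fcons. Qed.

Definition nondec n B (f : {ffun 'I_n -> 'I_B}) : bool :=
  [forall i : 'I_n, forall j : 'I_n, (i <= j)%N ==> (f i <= f j)%N].

Lemma nondecP n B (f : {ffun 'I_n -> 'I_B}) :
  reflect (forall i j : 'I_n, (i <= j)%N -> (f i <= f j)%N) (nondec f).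
Proof.
apply: (iffP forallP) => [h i j ij|h i].
  by have /forallP/(_ j)/implyP := h i; apply.
by apply/forallP=> j; apply/implyP; apply: h.
Qed.

Lemma nondec_fcons0 n B (f : {ffun 'I_n -> 'I_B.+1}) : nondec (fcons ord0 f) = nondec f.
Proof.
apply/nondecP/nondecP => h i j ij.
  by have := h (lift ord0 i) (lift ord0 j); rewrite !fconsS; apply; rewrite /= /bump /=; lia.
case: (unliftP ord0 i) ij => [i'|] -> ij; last by rewrite fcons0.
case: (unliftP ord0 j) ij => [j'|] -> ij; last by [].
by rewrite !fconsS; apply: h; move: ij; rewrite /= /bump /=; lia.
Qed.

Lemma nondec_lift n B (h : 'I_B.+1) (f : {ffun 'I_n -> 'I_B}) :
  nondec [ffun i => lift h (f i)] = nondec f.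
Proof.
by apply: eq_forallb => i; apply: eq_forallb => j; rewrite !ffunE /= leq_bump2.
Qed.

Lemma sum_nondec_avoid (R : nmodType) n B (h : 'I_B.+1)
    (F : {ffun 'I_n -> 'I_B.+1} -> R) :
  \sum_(f | nondec f && [forall i, f i != h]) F f =
  \sum_(f : {ffun 'I_n -> 'I_B} | nondec f) F [ffun i => lift h (f i)].
Proof.
case: n F => [|n] F.
  have e (T : finType) (f g : {ffun 'I_0 -> T}) : f = g by apply/ffunP; case.
  have f0 : {ffun 'I_0 -> 'I_B}.
    by apply: finfun => -[].
  rewrite (big_pred1 [ffun i => lift h (f0 i)]).
    rewrite (big_pred1 f0) // => f /=; rewrite (e _ f f0) eqxx.
    by apply/nondecP; case.
  move=> f /=; rewrite (e _ f [ffun i => lift h (f0 i)]) eqxx.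
  apply/andP; split; first by apply/nondecP; case.
  by apply/forallP; case.
case: B h F => [|B] h F.
  rewrite big_pred0 => [|f].
    by rewrite big_pred0 // => f; case: (f ord0).
  by apply/negbTE/nandP; right; apply/forallPn; exists ord0; rewrite !ord1 eqxx.
pose u (f : {ffun 'I_n.+1 -> 'I_B.+2}) : {ffun 'I_n.+1 -> 'I_B.+1} :=
  [ffun i => odflt ord0 (unlift h (f i))].
pose l (f : {ffun 'I_n.+1 -> 'I_B.+1}) : {ffun 'I_n.+1 -> 'I_B.+2} :=
  [ffun i => lift h (f i)].
rewrite (reindex_onto l u) => [|f /andP[_ /forallP nf]].
  apply: eq_bigl => f; rewrite nondec_lift.
  have -> : [forall i, l f i != h].
    by apply/forallP=> i; rewrite ffunE eq_sym neq_lift.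
  rewrite andbT; case: (nondec f) => //=.
  by apply/eqP/ffunP=> i; rewrite !ffunE liftK.
apply/ffunP=> i; rewrite !ffunE; have := nf i.
by case: (unliftP h (f i)) => [j|] -> /=; rewrite ?eqxx ?liftK.
Qed.

Definition littlewood_denom (R : comNzRingType) n (x : 'I_n -> R) : R :=
  \prod_(i < n) \prod_(j < n | (i <= j)%N) (1 - x i * x j).

Lemma littlewood_denom_lift (R : comNzRingType) n (x : 'I_n.+1 -> R) k :
  littlewood_denom x = littlewood_denom (x \o lift k) * \prod_j (1 - x k * x j).
Proof.
rewrite /littlewood_denom (bigD1_ord k) //= mulrC [in RHS](bigD1_ord k) //=.
have -> : \prod_(j < n.+1 | (k <= j)%N) (1 - x k * x j) =
    (1 - x k * x k) *
    \prod_(j < n | (k <= lift k j)%N) (1 - x k * x (lift k j)).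
  by rewrite (bigD1_ord k).
rewrite (eq_bigr (fun i : 'I_n =>
     (if (lift k i <= k)%N then 1 - x k * x (lift k i) else 1) *
     \prod_(j < n | (i <= j)%N) (1 - x (lift k i) * x (lift k j)))); last first.
  move=> i _; rewrite big_mkcond (bigD1_ord k) //= mulrC [x k * _]mulrC mulrC.
  by congr (_ * _); rewrite -big_mkcond; apply: eq_bigl => j; rewrite leq_bump2.
rewrite big_split /= [LHS](_ : _ = (1 - x k * x k) * (\prod_(j < n) \prod_(j0 < n | (j <= j0)%N)
   (1 - x (lift k j) * x (lift k j0)) * (\prod_(j < n | (k <= lift k j)%N) (1 - x k * x (lift k j)) *
   \prod_(j < n) (if (bump k j <= k)%N then 1 - x k * x (lift k j) else 1)))); last by ring.
rewrite [RHS](_ : _ = (1 - x k * x k) * (\prod_(j < n) \prod_(j0 < n | (j <= j0)%N)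
   (1 - x (lift k j) * x (lift k j0)) * \prod_(j < n) (1 - x k * x (lift k j)))); last by ring.
do 2! congr (_ * _).
rewrite [X in X * _]big_mkcond -big_split /=; apply: eq_bigr => i _.
rewrite /bump; case: (leqP k i) => h1 /=.
  by rewrite ifT ?ifF ?mulr1 //; lia.
by rewrite ifF ?ifT ?mul1r //; lia.
Qed.

(** Littlewood's identity is between infinite series. Working modulo an ideal
    that contains high powers of the variables keeps the sums finite without
    building a ring of power series. *)
Definition ideal (R : comNzRingType) (I : R -> Prop) : Prop :=
  [/\ I 0, forall a b, I a -> I b -> I (a + b) & forall a b, I b -> I (a * b)].

Lemma ideal_sum (R : comNzRingType) (I : R -> Prop) (T : finType) (P : pred T) F :
  ideal I -> (forall i, P i -> I (F i)) -> I (\sum_(i | P i) F i).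
Proof. by case=> I0 IA _; apply: big_ind. Qed.

Lemma ideal_alt (R : comNzRingType) (I : R -> Prop) n (x : 'I_n -> R) b j m :
  ideal I -> (forall i, I (x i ^+ m)) -> (m <= b j)%N -> I (alt x b).
Proof.
move=> II Ix mb; rewrite /alt (expand_det_col _ j); apply: ideal_sum => // i _.
have [_ _ IM] := II.
by rewrite mxE -(subnKC mb) exprD -mulrA mulrC; apply: (IM).
Qed.

(** Parts are listed in increasing order, so index 0 is the smallest one. *)
Definition even_sum (R : comNzRingType) n (x : 'I_n -> R) B : R :=
  \sum_(f : {ffun 'I_n -> 'I_B} | nondec f) alt x (fun j => (f j).*2 + j)%N.

(** Raising the bound on the parts only adds alternants that contain a high
    power of the variables. *)
Lemma even_sumS (R : comNzRingType) (I : R -> Prop) n (x : 'I_n -> R) B :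
  ideal I -> (forall i, I (x i ^+ B.*2)) -> I (even_sum x B.+1 - even_sum x B).
Proof.
move=> II Ix; rewrite /even_sum.
have -> : \sum_(f : {ffun 'I_n -> 'I_B} | nondec f) alt x (fun j => (f j).*2 + j)%N =
  \sum_(f : {ffun 'I_n -> 'I_B.+1} | nondec f && [forall i, f i != ord_max])
     alt x (fun j => (f j).*2 + j)%N.
  rewrite sum_nondec_avoid; apply: eq_bigr => f _; apply: eq_alt => j.
  by rewrite ffunE lift_max.
rewrite (bigID (fun f : {ffun 'I_n -> 'I_B.+1} => [forall i, f i != ord_max])) /=.
rewrite addrAC subrr add0r; apply: ideal_sum => // f /andP[_ /forallPn[i]].
rewrite negbK => /eqP fi; apply: (@ideal_alt _ _ _ _ _ i B.*2) => //.
by rewrite fi /= leq_addr.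
Qed.

(** Either the smallest part is positive, and 2 can be subtracted from every part,
    or it is 0, and Laplace expansion along the column of ones removes one
    variable. *)
Lemma even_sum_rec (R : comNzRingType) n (x : 'I_n.+1 -> R) B :
  even_sum x B.+1 = (\prod_i x i) ^+ 2 * even_sum x B +
   \sum_(k < n.+1) (-1) ^+ k * (\prod_j x (lift k j) * even_sum (x \o lift k) B.+1).
Proof.
rewrite /even_sum.
rewrite (bigID (fun f : {ffun 'I_n.+1 -> 'I_B.+1} => [forall i, f i != ord0])) /=.
rewrite sum_nondec_avoid mulr_sumr; congr (_ + _).
  apply: eq_bigr => f _; rewrite -alt_addn; apply: eq_alt => j.
  by rewrite ffunE /= /bump /=; lia.
rewrite (eq_bigl (fun f : {ffun 'I_n.+1 -> 'I_B.+1} => nondec f && (f ord0 == ord0))).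
  rewrite sum_fcons (bigD1 ord0) //= [X in _ + X]big1 ?addr0 => [|a a0]; last first.
       by rewrite big1 // => g; rewrite fcons0 (negbTE a0) andbF.
  rewrite (eq_bigl (fun f => nondec f)); last first.
    by move=> f; rewrite fcons0 eqxx andbT nondec_fcons0.
  rewrite (eq_bigr (fun f : {ffun 'I_n -> 'I_B.+1} => \sum_(k < n.+1)
     (-1) ^+ k * (\prod_j x (lift k j) * alt (x \o lift k) (fun j => (f j).*2 + j)%N))).
    rewrite exchange_big; apply: eq_bigr => k _ /=.
    by rewrite !mulr_sumr.
  move=> f _; transitivity (\sum_(k < n.+1) 1 * ((-1) ^+ k *
      (\prod_j x (lift k j) * alt (x \o lift k) (fun j => (f j).*2 + j)%N))).
    rewrite -(alt_expand0 x (fun=> 1)); congr (\det _); apply/matrixP=> i j.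
    rewrite !mxE; case: (unliftP ord0 j) => [j'|] ->; last by rewrite fcons0 expr0.
    by rewrite fconsS /= /bump /= addnCA.
  by apply: eq_bigr => k _; rewrite mul1r.
move=> f; apply: andb_id2l => /nondecP fi; apply/forallPn/eqP => [[i]|f0].
  rewrite negbK => /eqP e; apply/val_inj/eqP; rewrite -leqn0.
  by apply: leq_trans (fi ord0 i _) _; rewrite ?e.
by exists ord0; rewrite f0 eqxx.
Qed.

(** Littlewood's identity: the sum of the Schur polynomials of the partitions
    with even parts is [prod_(i <= j) (1 - x_i x_j)^-1]. By [even_sum_rec] and
    induction, [alt_lagrange] evaluates the difference of the two sides times
    [1 - (prod_i x_i) ^+ 2], and this factor is invertible modulo the ideal. *)
Lemma littlewood_even (R : comNzRingType) (I : R -> Prop) n (x : 'I_n -> R) B :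
  ideal I -> (forall i, I (x i ^+ B.*2)) ->
  I (littlewood_denom x * even_sum x B - alt x (fun j => j)).
Proof.
move=> II; have [I0 IA IM] := II.
elim: n x B => [|n IHn] x B Ix.
  rewrite /littlewood_denom big_ord0 mul1r /even_sum.
  have f0 : {ffun 'I_0 -> 'I_B} by apply: finfun => -[].
  rewrite (big_pred1 f0) => [|f]; first by rewrite /alt !det_mx00 subrr.
  have -> : f = f0 by apply/ffunP; case.
  by rewrite /= eqxx; apply/nondecP; case.
set E := \prod_i x i; set A := even_sum x B; set P := littlewood_denom x.
set y := P * A - _.
have Iy : I (y - E ^+ 2 * y).
  have Ixk k i : I ((x \o lift k) i ^+ B.+1.*2).
    by rewrite doubleS -addn2 exprD mulrC; apply: (IM); apply: Ix.
  have -> : y - E ^+ 2 * y = P * (A - even_sum x B.+1) +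
    (P * (even_sum x B.+1 - E ^+ 2 * A) - (1 - E ^+ 2) * alt x (fun j => j)).
    by rewrite /y; ring.
  apply: (IA); first by apply: (IM); rewrite -opprB -mulN1r; apply: (IM); apply: even_sumS.
  rewrite even_sum_rec -/E -/A addrAC subrr add0r -alt_lagrange mulr_sumr -sumrB.
  apply: ideal_sum => // k _.
  rewrite /P (littlewood_denom_lift x k).
  set a := littlewood_denom _; set b := even_sum _ _; set c := alt _ _.
  have -> : a * \prod_j (1 - x k * x j) * ((-1) ^+ k * (\prod_j x (lift k j) * b)) -
     \prod_j (1 - x k * x j) * ((-1) ^+ k * (\prod_j x (lift k j) * c)) =
     (\prod_j (1 - x k * x j) * ((-1) ^+ k * \prod_j x (lift k j))) * (a * b - c).
    ring.
  by apply: (IM); apply: IHn; apply: Ixk.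
(* The factor [1 - E ^+ 2] is cancelled by iterating to a power of [E] in the ideal. *)
have Em m : I (y - E ^+ m.*2 * y).
  elim: m => [|m IH]; first by rewrite mul1r subrr.
  have -> : y - E ^+ m.+1.*2 * y = (y - E ^+ 2 * y) + E ^+ 2 * (y - E ^+ m.*2 * y).
    by rewrite doubleS -addn2 exprD; ring.
  by apply: (IA) => //; apply: (IM).
rewrite -[y](subrK (E ^+ B.*2 * y)); apply: (IA) => //.
rewrite mulrC; apply: (IM); rewrite /E (bigD1 ord0) //= exprMn mulrC.
by apply: (IM).
Qed.

Definition elem_sym (R : comNzRingType) n (x : 'I_n -> R) p : R :=
  \sum_(f : {ffun 'I_n -> bool} | (\sum_i f i == p)%N) \prod_i x i ^+ f i.

(** Pieri's rule before terms with repeated exponents are dropped. *)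
Lemma pieri_alt (R : comNzRingType) n (x : 'I_n -> R) b p :
  elem_sym x p * alt x b =
  \sum_(f : {ffun 'I_n -> bool} | (\sum_i f i == p)%N) alt x (fun j => b j + f j)%N.
Proof.
rewrite /alt /determinant exchange_big mulr_sumr; apply: eq_bigr => s _ /=.
rewrite -mulr_sumr mulrCA; congr (_ * _).
rewrite /elem_sym (reindex_inj (h := fun f : {ffun 'I_n -> bool} => [ffun i => f (s i)])).
  rewrite mulr_suml; apply: eq_big => [f|f _].
    congr (_ == p); rewrite [RHS](reindex_inj (@perm_inj _ s)).
    by apply: eq_bigr => i _; rewrite ffunE.
  rewrite -big_split; apply: eq_bigr => i _ /=.
  by rewrite !mxE ffunE exprD mulrC.
move=> f g /ffunP e; apply/ffunP=> i.
by have := e (s^-1%g i); rewrite !ffunE permKV.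
Qed.

(** * Vandermonde determinants *)

Lemma det_vandermonde (R : comNzRingType) n (x : 'I_n -> R) :
  alt x (fun j => j) = \prod_(i < n) \prod_(j < n | (i < j)%N) (x j - x i).
Proof.
rewrite /alt -det_tr.
have -> : (\matrix_(i, j) x i ^+ j)^T = Vandermonde n (\row_i x i).
  by apply/matrixP=> i j; rewrite !mxE.
rewrite det_Vandermonde; apply: eq_bigr => i _; apply: eq_bigr => j _.
by rewrite !mxE.
Qed.

Lemma prod_pairs (R : comNzRingType) n (a : 'I_n -> R) :
  \prod_(i < n) \prod_(j < n | (i < j)%N) (a i * a j) = \prod_i a i ^+ n.-1.
Proof.
transitivity (\prod_(i < n) ((\prod_(j < n | (i < j)%N) a i) *
                               (\prod_(j < n | (j < i)%N) a i))).
  rewrite big_split /= [X in _ * X](exchange_big_dep xpredT) //= -big_split /=.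
  by apply: eq_bigr => i _; rewrite big_split.
apply: eq_bigr => i _; rewrite !prodr_const -exprD; congr (_ ^+ _).
have := cardC1 i; rewrite card_ord => <-.
rewrite -(cardID (fun j : 'I_n => (i < j)%N) (predC1 i)).
by congr addn; apply: eq_card => j; rewrite !inE -val_eqE /=; lia.
Qed.

Lemma det_hom_vandermonde_unit (F : fieldType) n (a b : 'I_n -> F) :
  (forall i, a i != 0) ->
  \det (\matrix_(i, j < n) (a i ^+ (n.-1 - j) * b i ^+ j)) =
  \prod_(i < n) \prod_(j < n | (i < j)%N) (a i * b j - a j * b i).
Proof.
move=> a0.
have -> : \matrix_(i, j < n) (a i ^+ (n.-1 - j) * b i ^+ j) =
  diag_mx (\row_i a i ^+ n.-1) *m (\matrix_(i, j) (b i / a i) ^+ j).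
  apply/matrixP=> i j; rewrite mul_diag_mx !mxE expr_div_n mulrCA mulrC.
  rewrite -expfB_cond // (negbTE (a0 i)) add0n; have := ltn_ord j; lia.
rewrite det_mulmx det_diag -[X in _ * X]/(alt (fun i => b i / a i) (fun j => j)).
rewrite det_vandermonde (eq_bigr (fun i => a i ^+ n.-1)) => [|i _]; last by rewrite mxE.
rewrite -prod_pairs -big_split /=; apply: eq_bigr => i _.
rewrite -big_split /=; apply: eq_bigr => j _.
by rewrite mulrBr; field; rewrite a0 a0.
Qed.

Lemma det_hom_vandermonde (R : idomainType) n (a b : 'I_n -> R) :
  (forall i, a i != 0) ->
  \det (\matrix_(i, j < n) (a i ^+ (n.-1 - j) * b i ^+ j)) =
  \prod_(i < n) \prod_(j < n | (i < j)%N) (a i * b j - a j * b i).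
Proof.
move=> a0; apply/eqP; rewrite -tofrac_eq -det_map_mx rmorph_prod /=.
rewrite (eq_bigr (fun i : 'I_n => \prod_(j < n | (i < j)%N)
   (tofrac (a i) * tofrac (b j) - tofrac (a j) * tofrac (b i)))); last first.
  move=> i _; rewrite rmorph_prod; apply: eq_bigr => j _.
  by rewrite rmorphB !rmorphM.
rewrite -(@det_hom_vandermonde_unit _ n (fun i => tofrac (a i)) (fun i => tofrac (b i))).
  apply/eqP; congr (\det _); apply/matrixP=> i j.
  by rewrite !mxE rmorphM !rmorphXn.
by move=> i; rewrite tofrac_eq0.
Qed.

(** * Coefficient extraction in several variables *)

Lemma poly_sumX (R : nzRingType) (q : {poly R}) m : (size q <= m)%N ->
  q = \sum_(k < m) q`_k *: 'X^k.
Proof.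
move=> sq; rewrite -(poly_def m (fun k => q`_k)); apply/polyP=> k; rewrite coef_poly.
by case: ltnP => // mk; rewrite nth_default // (leq_trans sq).
Qed.

(** Entries of the determinants of interest are values of this linear form; its
    tensor power [mextract] turns identities between polynomials in one variable
    per row into identities between such determinants. *)
Definition extract (R : comNzRingType) (E : {poly R}) K (q : {poly R}) : R := (E * q)`_K.

Lemma extractXn (R : comNzRingType) (E : {poly R}) K b q :
  extract E K ('X^b * q) = if (b <= K)%N then (E * q)`_(K - b) else 0.
Proof. by rewrite /extract mulrCA coefXnM ltnNge; case: leqP. Qed.

Lemma extract_sum (R : comNzRingType) (E : {poly R}) K (q : {poly R}) m : (size q <= m)%N ->
  extract E K q = \sum_(k < m) q`_k * extract E K 'X^k.
Proof.
move=> sq; rewrite /extract {1}(poly_sumX sq) mulr_sumr coef_sum.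
by apply: eq_bigr => k _; rewrite -scalerAr coefZ.
Qed.

(** The bound K on the exponents loses nothing: [extract E K 'X^m = 0] for m > K. *)
Definition mextract (R : comNzRingType) (E : {poly R}) K n (p : {mpoly R[n]}) : R :=
  \sum_(f : {ffun 'I_n -> 'I_K.+1})
     p@_[multinom (f i : nat) | i < n] * \prod_i extract E K 'X^(f i).

Lemma mextract_is_linear (R : comNzRingType) E K n :
  linear (@mextract R E K n : {mpoly R[n]} -> R^o).
Proof.
move=> a p q; rewrite /mextract scaler_sumr -big_split; apply: eq_bigr => f _.
by rewrite mcoeffD mcoeffZ mulrDl /= /GRing.scale /= mulrA.
Qed.

HB.instance Definition _ (R : comNzRingType) E K n :=
  GRing.isLinear.Build R {mpoly R[n]} R^o _ (@mextract R E K n)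
    (@mextract_is_linear R E K n).

Lemma mextractZ (R : comNzRingType) E K n a (p : {mpoly R[n]}) :
  mextract E K (a *: p) = a * mextract E K p.
Proof. exact: linearZ. Qed.

Lemma mextract_sum (R : comNzRingType) E K n (T : Type) (s : seq T) (P : pred T)
    (F : T -> {mpoly R[n]}) :
  mextract E K (\sum_(i <- s | P i) F i) = \sum_(i <- s | P i) mextract E K (F i).
Proof. exact: (linear_sum (@mextract R E K n : {linear {mpoly R[n]} -> R^o})). Qed.

Lemma mextractN (R : comNzRingType) E K n (p : {mpoly R[n]}) :
  mextract E K (- p) = - mextract E K p.
Proof. exact: (linearN (@mextract R E K n : {linear {mpoly R[n]} -> R^o})). Qed.

Lemma mextractX (R : comNzRingType) (E : {poly R}) K n (m : 'X_{1..n}) :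
  mextract E K 'X_[m] = \prod_i extract E K 'X^(m i).
Proof.
rewrite /mextract.
have [/forallP mK|/forallPn[i]] := boolP [forall i, m i <= K]%N.
  pose f0 : {ffun 'I_n -> 'I_K.+1} := [ffun i => inord (m i)].
  have f0E i : f0 i = m i :> nat by rewrite ffunE inordK // ltnS.
  rewrite (bigD1 f0) //= [X in _ + X]big1 ?addr0 => [|f ff0]; last first.
    rewrite mcoeffX; have [e|_] := eqVneq m _; last by rewrite mul0r.
    case/eqP: ff0.
    by apply/ffunP=> i; apply: val_inj; rewrite /= f0E e mnmE.
  rewrite mcoeffX; case: eqP => [_|[]]; last by apply/mnmP=> i; rewrite mnmE f0E.
  by rewrite mul1r; apply: eq_bigr => i _; rewrite f0E.
rewrite -ltnNge => Ki; rewrite [RHS](bigD1 i) //= -[X in extract _ _ X]mulr1.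
rewrite extractXn leqNgt Ki mul0r big1 // => f _; rewrite mcoeffX.
have [e|_] := eqVneq m _; last by rewrite mul0r.
by move: Ki; rewrite e mnmE ltnNge -ltnS ltn_ord.
Qed.

Lemma horner_alg_sum (R : comNzRingType) (A : algType R) (x : A) (q : {poly R}) m : (size q <= m)%N ->
  horner_alg x q = \sum_(k < m) q`_k *: x ^+ k.
Proof.
move=> /poly_sumX {1}->; rewrite linear_sum; apply: eq_bigr => k _ /=.
by rewrite linearZ /= rmorphXn /= horner_algX mulr_algl.
Qed.

Lemma mextract_prod (R : comNzRingType) (E : {poly R}) K n (q : 'I_n -> {poly R}) :
  mextract E K (\prod_i horner_alg ('X_i : {mpoly R[n]}) (q i)) =
  \prod_i extract E K (q i).
Proof.
pose m := (\max_i size (q i))%N.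
have sq i : (size (q i) <= m)%N by rewrite /m leq_bigmax.
under eq_bigr => i _ do rewrite (horner_alg_sum _ (sq i)).
rewrite bigA_distr_bigA mextract_sum.
rewrite [RHS](eq_bigr (fun i => \sum_(k < m) (q i)`_k * extract E K 'X^k)); last first.
  by move=> i _; apply: extract_sum.
rewrite bigA_distr_bigA; apply: eq_bigr => f _ /=.
rewrite scaler_prod big_split /= mextractZ; congr (_ * _).
have -> : \prod_i ('X_i : {mpoly R[n]}) ^+ f i = 'X_[[multinom (f i : nat) | i < n]].
  by rewrite mpolyXE_id; apply: eq_bigr => i _; rewrite mnmE.
by rewrite mextractX; apply: eq_bigr => i _; rewrite mnmE.
Qed.

Lemma mextract_det (R : comNzRingType) (E : {poly R}) K n (q : 'I_n -> 'I_n -> {poly R}) :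
  mextract E K (\det (\matrix_(i, j) horner_alg ('X_i : {mpoly R[n]}) (q i j))) =
  \det (\matrix_(i, j) extract E K (q i j)).
Proof.
rewrite /determinant mextract_sum; apply: eq_bigr => s _ /=.
rewrite !mulr_sign; have -> (b : bool) (p : {mpoly R[n]}) :
  mextract E K (if b then - p else p) = if b then - mextract E K p else mextract E K p.
  by case: b; rewrite ?mextractN.
rewrite (eq_bigr (fun i => horner_alg ('X_i : {mpoly R[n]}) (q i (s i)))) ?mextract_prod.
  by rewrite [in RHS](eq_bigr (fun i => extract E K (q i (s i)))) // => i _; rewrite mxE.
by move=> i _; rewrite mxE.
Qed.

(** Expanding the alternant, each permutation of the exponents permutes the rows
    of the determinant on the right; the two signs cancel, and all n! terms are
    equal. *)
Lemma mextract_det_alt (R : comNzRingType) (E : {poly R}) K n (g : 'I_n -> {poly R}) b :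
  mextract E K (\det (\matrix_(i, j) horner_alg ('X_i : {mpoly R[n]}) (g j)) *
     alt (fun i => 'X_i) b) =
  n`!%:R * \det (\matrix_(i, j) extract E K ('X^(b i) * g j)).
Proof.
rewrite /alt {2}/determinant mulr_sumr mextract_sum /=.
rewrite -card_Sn -sumr_const mulr_suml; apply: eq_big => [//|s _].
transitivity (mextract E K ((-1) ^+ s *
   \det (\matrix_(i, j) horner_alg ('X_i : {mpoly R[n]}) ('X^(b (s i)) * g j)))).
  rewrite mulrCA; congr (mextract _ _ (_ * _)).
  have -> : \matrix_(i, j) horner_alg ('X_i : {mpoly R[n]}) ('X^(b (s i)) * g j) =
    diag_mx (\row_i 'X_i ^+ b (s i)) *m \matrix_(i, j) horner_alg 'X_i (g j).
    apply/matrixP=> i j; rewrite mul_diag_mx !mxE rmorphM rmorphXn /= horner_algX //.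
  rewrite det_mulmx det_diag mulrC; congr (_ * _).
  by apply: eq_bigr => i _; rewrite !mxE.
have -> (p : {mpoly R[n]}) :
  mextract E K ((-1) ^+ s * p) = (-1) ^+ s * mextract E K p.
  by rewrite !mulr_sign; case: odd_perm; rewrite ?mextractN.
rewrite mextract_det.
have -> : \matrix_(i, j) extract E K ('X^(b (s i)) * g j) =
   row_perm s (\matrix_(i, j) extract E K ('X^(b i) * g j)).
  by apply/matrixP=> i j; rewrite !mxE.
by rewrite row_permE det_mulmx det_perm mulrA -expr2 sqrr_sign.
Qed.

(** The largest ideal on which the extraction vanishes: the place where
    [littlewood_even] is applied. *)
Definition mextract_ker (R : comNzRingType) (E : {poly R}) K n (p : {mpoly R[n]}) : Prop :=
  forall q, mextract E K (q * p) = 0.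

Lemma ideal_mextract_ker (R : comNzRingType) (E : {poly R}) K n :
  ideal (@mextract_ker R E K n).
Proof.
pose L : {linear {mpoly R[n]} -> R^o} := @mextract R E K n.
split=> [q|a b Ia Ib q|a b Ib q]; first by rewrite mulr0; apply: (linear0 L).
  by rewrite mulrDr; have := linearD L (q * a) (q * b); rewrite /= Ia Ib addr0.
by rewrite mulrA Ib.
Qed.

Lemma mextract_kerX (R : comNzRingType) (E : {poly R}) K n (i : 'I_n) m :
  (K < m)%N -> mextract_ker E K ('X_i ^+ m : {mpoly R[n]}).
Proof.
move=> Km q; rewrite [q]mpolyE mulr_suml mextract_sum big1 // => d _ /=.
rewrite -scalerAl mextractZ mpolyXn -mpolyXD mextractX (bigD1 i) //=.
rewrite mnmDE mulmnE mnm1E eqxx mul1n -['X^_]mulr1 extractXn leqNgt.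
by rewrite ltn_addl // mul0r mulr0.
Qed.

(** * Summation over the main diagonal *)

(** Another basis of the span of 1, X, ..., X^(c-1) with the same determinant as
    [X^(c-1-j)]; this one leads to binomial coefficients with falling factorials
    in increasing order. *)
Definition gl_col c j : {poly rat} := (1 + 'X) ^+ (c.-1 - j).

(** The Weyl denominator of type C is the product of the denominator in
    Littlewood's identity and a Vandermonde determinant, since
    [x_i (1 + x_j^2) - x_j (1 + x_i^2) = (x_i - x_j) (1 - x_i x_j)]. *)
Lemma det_sp_col n :
  \det (\matrix_(i, j < n) horner_alg ('X_i : {mpoly rat[n]}) (sp_col n j)) =
  littlewood_denom (fun i : 'I_n => 'X_i : {mpoly rat[n]}) *
  \det (\matrix_(i, j < n) horner_alg ('X_i : {mpoly rat[n]}) (gl_col n j)).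
Proof.
pose x (i : 'I_n) : {mpoly rat[n]} := 'X_i.
have x0 i : x i != 0 by rewrite -msize_poly_eq0 msizeX.
have x1 i : 1 + x i != 0.
  apply/eqP => /(congr1 (mcoeff U_(i)%MM)); rewrite mcoeffD mcoeff0 mcoeffX eqxx.
  by rewrite mcoeff1 mnm1_eq0 add0r => /eqP; rewrite oner_eq0.
have -> : \matrix_(i, j < n) horner_alg (x i) (sp_col n j) =
   diag_mx (\row_i (1 - x i ^+ 2)) *m
     \matrix_(i, j < n) (x i ^+ (n.-1 - j) * (1 + x i ^+ 2) ^+ j).
  apply/matrixP=> i j; rewrite mul_diag_mx !mxE /sp_col !rmorphM !rmorphXn.
  by rewrite !rmorphD rmorphN rmorph1 !rmorphXn /= horner_algX mulrCA.
have -> : \matrix_(i, j < n) horner_alg (x i) (gl_col n j) =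
     \matrix_(i, j < n) ((1 + x i) ^+ (n.-1 - j) * 1 ^+ j).
  apply/matrixP=> i j; rewrite !mxE /gl_col rmorphXn rmorphD rmorph1 /=.
  by rewrite horner_algX expr1n mulr1.
rewrite det_mulmx det_diag (det_hom_vandermonde _ x0).
rewrite (@det_hom_vandermonde _ n (fun i => 1 + x i) (fun=> 1)) //.
rewrite /littlewood_denom -!big_split; apply: eq_bigr => i _ /=.
rewrite mxE [in RHS](bigD1 i) //= -mulrA; congr (_ * _).
rewrite [X in _ = X * _](eq_bigl (fun j : 'I_n => (i < j)%N)); last first.
  by move=> j; rewrite -val_eqE /=; lia.
by rewrite -big_split /=; apply: eq_bigr => j _; rewrite -/(x i) -/(x j); ring.
Qed.

(** Apply the extraction to [D * e_p * A], where [D] is the Weyl denominator, [e_p]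
    the elementary symmetric polynomial and [A] the sum of alternants over even
    partitions. Pieri's rule gives the left side. On the other hand [D = P * V],
    and Littlewood's identity replaces [P * A] by a single alternant, which
    gives the right side. *)
Lemma symplectic_sum (E : {poly rat}) K n p B : (K < B.*2)%N ->
  \sum_(k : {ffun 'I_n -> 'I_B} | nondec k)
   \sum_(f : {ffun 'I_n -> bool} | (\sum_i f i == p)%N)
     \det (\matrix_(i, j < n) extract E K ('X^((k i).*2 + i + f i) * sp_col n j)) =
  \sum_(f : {ffun 'I_n -> bool} | (\sum_i f i == p)%N)
     \det (\matrix_(i, j < n) extract E K ('X^(i + f i) * gl_col n j)).
Proof.
move=> KB.
pose x (i : 'I_n) : {mpoly rat[n]} := 'X_i.
pose V := \det (\matrix_(i, j < n) horner_alg (x i) (gl_col n j)).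
pose D := \det (\matrix_(i, j < n) horner_alg (x i) (sp_col n j)).
have DE : D = littlewood_denom x * V := det_sp_col n.
apply: (@mulfI _ n`!%:R).
  by rewrite pnatr_eq0 -lt0n fact_gt0.
rewrite !mulr_sumr.
transitivity (mextract E K (D * (elem_sym x p * even_sum x B))).
  rewrite /even_sum !mulr_sumr linear_sum; apply: eq_bigr => k _ /=.
  rewrite pieri_alt !mulr_sumr linear_sum; apply: eq_bigr => f _ /=.
  by rewrite mextract_det_alt.
transitivity (mextract E K (V * (elem_sym x p * alt x (fun j => j)))); last first.
  rewrite pieri_alt !mulr_sumr linear_sum; apply: eq_bigr => f _ /=.
  by rewrite mextract_det_alt.
apply/eqP; rewrite -subr_eq0 -linearB /=.
have := littlewood_even (ideal_mextract_ker E K n) (fun i => mextract_kerX E i KB).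
move=> /(_ (V * elem_sym x p)) e; apply/eqP; rewrite -[RHS]e; congr mextract.
by rewrite DE -/x; ring.
Qed.

Lemma sum_geq n m : (\sum_(j < n) (m <= j) = n - m)%N.
Proof. by elim: n => [|n IH]; rewrite ?big_ord0 // big_ord_recr /= IH; lia. Qed.

Lemma top_bits n p (f : {ffun 'I_n -> bool}) : (\sum_i f i = p)%N ->
  (forall i j : 'I_n, j = i.+1 :> nat -> f i ==> f j) ->
  f = [ffun i : 'I_n => n - p <= i]%N.
Proof.
move=> sf fs.
have fle (i j : 'I_n) : (i <= j)%N -> f i ==> f j.
  apply: (@ord_chain _ implb n f) => //; first by case.
  by case; case; case.
apply/ffunP=> i; rewrite ffunE; have := ltn_ord i.
case fi : (f i).
  suff : (n - i <= p)%N by lia.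
  rewrite -sum_geq -sf; apply: leq_sum => j _.
  by case: (leqP i j) => // ij; have := fle _ _ ij; rewrite fi => /= ->.
suff : (p <= n - i.+1)%N by lia.
rewrite -sum_geq -sf; apply: leq_sum => j _.
case: (ltnP i j) => ij; first by rewrite leq_b1.
by have := fle _ _ ij; rewrite fi implybF => /negbTE ->.
Qed.

(** A subset f of the columns is raised by one; unless it consists of the last p
    columns, two exponents, hence two rows, coincide. *)
Lemma linear_sum_single (E : {poly rat}) K n p :
  \sum_(f : {ffun 'I_n -> bool} | (\sum_i f i == p)%N)
     \det (\matrix_(i, j < n) extract E K ('X^(i + f i) * gl_col n j)) =
  if (p <= n)%N then
    \det (\matrix_(i, j < n) extract E K ('X^(i + (n - p <= i)%N) * gl_col n j))
  else 0.
Proof.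
case: ifP => [pn|/negbT np]; last first.
  rewrite big_pred0 // => f; apply/negbTE; apply: contra np => /eqP <-.
  rewrite -[X in (_ <= X)%N]card_ord -sum1_card; apply: leq_sum => i _.
  exact: leq_b1.
pose f0 := [ffun i : 'I_n => n - p <= i]%N.
have f0p : (\sum_i f0 i == p)%N.
  by under eq_bigr do rewrite ffunE; rewrite sum_geq subKn.
rewrite (bigD1 f0) //= [X in _ + X]big1 ?addr0 => [|f /andP[/eqP fp ff0]].
  by congr (\det _); apply/matrixP=> i j; rewrite !mxE ffunE.
have [/existsP[i /existsP[j /and3P[/eqP ij fi fj]]]|] :=
  boolP [exists i : 'I_n, exists j : 'I_n, [&& (j == i.+1 :> nat), f i & ~~ f j]].
  have ne : i != j by rewrite -val_eqE /= ij; lia.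
  apply: (determinant_alternate ne) => l; rewrite !mxE ij fi (negbTE fj).
  by rewrite addn0 addn1.
move=> /existsPn h; case/eqP: ff0; apply: top_bits => // i j ij.
apply/implyP => fi; have /existsPn/(_ j) := h i.
by rewrite ij eqxx fi /= negbK.
Qed.

(** Columns [v i] of a diagonal inside the rectangle with r rows are the
    complements [r - v i = 2 k i + f i], with [f i] recording the wrong parity.
    The pairs (k, f) that do not come from a diagonal have two equal rows, or a
    zero row when a column would have negative length. *)
Lemma sum_sp_det N r c p :
  \sum_(v : {ffun 'I_c -> 'I_r.+1} |
        noninc v && (\sum_i (odd (v i) != odd r) == p)%N) sp_det N (fun i => v i) =
  \sum_(f : {ffun 'I_c -> bool} | (\sum_i f i == p)%N)
     \det (\matrix_(i, j < c)
        extract ((1 + 'X) ^+ N) (r + c.-1) ('X^(i + f i) * gl_col c j)).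
Proof.
(* Any bound on the halved parts works that makes [B.*2] exceed all exponents. *)
pose B := (r + c).+1.
rewrite -(@symplectic_sum _ _ c p B); last by rewrite /B; lia.
rewrite [RHS]pair_big_dep /=.
pose w (kf : {ffun 'I_c -> 'I_B} * {ffun 'I_c -> bool}) i := ((kf.1 i).*2 + kf.2 i)%N.
pose h (v : {ffun 'I_c -> 'I_r.+1}) : {ffun 'I_c -> 'I_B} * {ffun 'I_c -> bool} :=
  ([ffun i => inord (r - v i)./2], [ffun i => odd (r - v i)]).
pose h' kf : {ffun 'I_c -> 'I_r.+1} := [ffun i => inord (r - w kf i)].
have hw v i : w (h v) i = (r - v i)%N.
  rewrite /w !ffunE /= inordK; last by rewrite /B; lia.
  by rewrite addnC odd_double_half.
have h'w kf i : h' kf i = (r - w kf i)%N :> nat by rewrite ffunE inordK //; lia.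
pose good kf := [forall i : 'I_c, (w kf i <= r)%N] &&
  [forall i : 'I_c, forall j : 'I_c, (j == i.+1 :> nat) ==> (w kf i <= w kf j)%N].
rewrite [RHS](bigID good) /= [X in _ = _ + X]big1 ?addr0.
  rewrite [RHS](reindex_onto h h') => [|[k f] /andP[_ /andP[/forallP wr _]]].
    have hh v : h' (h v) = v.
      by apply/ffunP => i; apply: val_inj; rewrite /= h'w hw; have := ltn_ord (v i); lia.
    apply: eq_big => [v|v _].
      rewrite hh eqxx andbT.
      have -> : good (h v) = [forall i : 'I_c, forall j : 'I_c,
          (j == i.+1 :> nat) ==> (v j <= v i)%N].
        have -> : good (h v) = [forall i : 'I_c, forall j : 'I_c,
           (j == i.+1 :> nat) ==> (w (h v) i <= w (h v) j)%N].
          by rewrite /good; case: forallP => // -[i]; rewrite hw leq_subr.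
        apply: eq_forallb => i; apply: eq_forallb => j; rewrite !hw.
        by have := ltn_ord (v i); have := ltn_ord (v j); case: eqP => //=; lia.
      have -> : (\sum_i (h v).2 i)%N = (\sum_i (odd (v i) != odd r))%N.
        apply: eq_bigr => i _; rewrite ffunE oddB; last by have := ltn_ord (v i).
        by rewrite addbC; case: (odd _); case: (odd _).
      rewrite [RHS]andbAC; congr (_ && _).
      apply/nonincP/andP => [vd|[_ /forallP vd] i j ij].
        split; last first.
          by apply/forallP => i; apply/forallP => j; apply/implyP => /eqP ij; apply: vd; rewrite ij.
        apply/nondecP => i j ij; rewrite !ffunE !inordK /B; try lia.
        by have := vd _ _ ij; lia.
      apply: (@ord_chain _ geq c (fun i => v i : nat)) => {ij} //.
      - exact: leqnn.
      - by move=> a b d ab bd; apply: leq_trans bd ab.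
      - by move=> {}i {}j ij; have /forallP/(_ j) := vd i; rewrite ij eqxx.
    rewrite /sp_det; congr (\det _); apply/matrixP=> i j; rewrite !mxE extractXn.
    have := hw v i; rewrite /w /= => e.
    have := ltn_ord (v i); have := ltn_ord i => ic vr.
    by rewrite ifT /sp_row; [congr (_`_ _)|]; lia.
  have e i : w (h (h' (k, f))) i = w (k, f) i.
    by rewrite hw h'w subKn.
  rewrite /h; congr pair; apply/ffunP => i; rewrite !ffunE inordK ?ltnS ?leq_subr //.
    apply: val_inj; rewrite /= subKn // inordK /w /=.
      by rewrite addnC half_bit_double.
    by have := ltn_ord (k i); have := wr i; rewrite /w /B /=; lia.
  by rewrite subKn // /w /= oddD odd_double; case: (f i).
move=> [k f] /= /andP[/andP[/nondecP ki _] ng].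
have [/existsP[i /existsP[j /andP[/eqP ij wij]]]|nd] :=
  boolP [exists i : 'I_c, exists j : 'I_c, (j == i.+1 :> nat) && (w (k, f) j < w (k, f) i)%N].
  have ne : i != j by rewrite -val_eqE /= ij; lia.
  apply: (determinant_alternate ne) => l; rewrite !mxE.
  suff -> : ((k i).*2 + i + f i = (k j).*2 + j + f j)%N by [].
  have kij : (k i <= k j)%N by apply: ki; rewrite ij.
  by move: wij; rewrite /w /= ij; case: (f i); case: (f j); lia.
have nd' (i j : 'I_c) : j = i.+1 :> nat -> (w (k, f) i <= w (k, f) j)%N.
  move=> ij; have /existsPn/(_ i)/existsPn/(_ j) := nd.
  by rewrite ij eqxx /= -leqNgt.
have : ~~ [forall i : 'I_c, (w (k, f) i <= r)%N].
  apply: contra ng => wr; rewrite /good wr; apply/forallP => i; apply/forallP => j.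
  by apply/implyP => /eqP; apply: nd'.
move=> /forallPn[i]; rewrite -ltnNge => wi.
have c0 : (c.-1 < c)%N by have := ltn_ord i; lia.
pose l := Ordinal c0.
have wl : (r < w (k, f) l)%N.
  apply: leq_trans wi _.
  apply: (@ord_chain _ leq c (w (k, f))) => //; first exact: leq_trans.
  by have := ltn_ord i; rewrite /=; lia.
rewrite (expand_det_row _ l) big1 // => j _.
rewrite !mxE extractXn ifF ?mul0r //; apply/negbTE.
by move: wl; rewrite /w /=; lia.
Qed.

(** * Product formulas *)

Lemma coef_1X (R : comNzRingType) n k : ((1 + 'X : {poly R}) ^+ n)`_k = 'C(n, k)%:R.
Proof.
elim: n k => [|n IH] [|k]; rewrite ?expr0 ?coef1 // exprS mulrDl mul1r coefD coefXM /= !IH.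
  by rewrite !bin0 addr0.
by rewrite binS natrD.
Qed.

Lemma bin_ffact_sub M j k : (j <= M)%N -> (k <= M)%N ->
  ('C(M - j, k) * (k`! * (M - k)`!) = (M - j)`! * (M - k) ^_ j)%N.
Proof.
move=> jM kM; case: (leqP j (M - k)) => h; last first.
  by rewrite ffact_small // bin_small ?mul0n ?muln0 //; lia.
rewrite -(ffact_fact h) -(@bin_fact (M - j) k); last lia.
rewrite (_ : M - j - k = M - k - j)%N; last lia.
by rewrite !mulnA [RHS]mulnAC.
Qed.

Definition falling (j : nat) : {poly rat} := \prod_(l < j) ('X - (l%:R)%:P).

Lemma falling_horner j (y : nat) : (falling j).[y%:R] = (y ^_ j)%:R.
Proof.
elim: j => [|j IH]; first by rewrite /falling big_ord0 hornerC ffactn0.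
rewrite /falling big_ord_recr /= hornerM -/(falling j) IH hornerXsubC ffactnSr natrM.
case: (leqP j y) => h; first by rewrite natrB.
by rewrite ffact_small // !mul0r.
Qed.

(** Falling factorials are monic, so their matrix differs from a Vandermonde
    matrix by a unitriangular factor. *)
Lemma det_ffact n (y : 'I_n -> nat) :
  \det (\matrix_(i, j < n) ((y i ^_ j)%:R : rat)) =
  \prod_(i < n) \prod_(j < n | (i < j)%N) ((y j)%:R - (y i)%:R).
Proof.
pose x i : rat := (y i)%:R.
rewrite -(det_vandermonde x) /alt.
have sz j : size (falling j) = j.+1.
  by rewrite /falling size_prod_XsubC /index_enum -enumT size_enum_ord.
have mon j : falling j \is monic by apply: monic_prod_XsubC.
have -> : \matrix_(i, j < n) ((y i ^_ j)%:R : rat) =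
   (\matrix_(i, j < n) x i ^+ j) *m (\matrix_(l, j < n) (falling j)`_l).
  apply/matrixP=> i j; rewrite !mxE -falling_horner (@horner_coef_wide _ n) ?sz //.
  by apply: eq_bigr => l _; rewrite !mxE mulrC.
rewrite det_mulmx; suff -> : \det (\matrix_(l, j < n) (falling j)`_l) = 1 by rewrite mulr1.
rewrite -det_tr det_trig.
  rewrite big1 // => i _; rewrite !mxE.
  by have /monicP := mon i; rewrite lead_coefE sz.
by apply/is_trig_mxP => i j ij; rewrite !mxE nth_default // sz.
Qed.

Lemma prod_diff_above n m : (m <= n)%N ->
  \prod_(j < n.+1 | (m < j)%N) ((j%:R : rat) - m%:R) = ((n - m)`!)%:R.
Proof.
elim: n => [|n IH] mn.
  by rewrite big_pred0 // => j; rewrite ord1 ltn0.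
rewrite big_mkcond big_ord_recr -big_mkcond /=.
case: (ltngtP m n.+1) mn => // [mn|->] _; last first.
  by rewrite subnn big_pred0 ?mulr1 // => j; rewrite ltnNge ltnW.
by rewrite IH // subSn // factS natrM -subSn // natrB ?(ltnW mn) // mulrC.
Qed.

Lemma prod_diff_below n m : (m <= n)%N ->
  \prod_(i < n | (i < m)%N) ((m%:R : rat) - i%:R) = (m`!)%:R.
Proof.
move=> mn; rewrite -(big_ord_widen_cond n xpredT (fun i => (m%:R : rat) - i%:R)) //.
elim: m {mn} => [|m IH]; first by rewrite big_ord0.
rewrite big_ord_recl subr0 factS natrM -IH; congr (_ * _).
by apply: eq_bigr => i _; rewrite /= /bump /= -!natr1; ring.
Qed.

Lemma prod_nat_diff n :
  \prod_(i < n) \prod_(j < n | (i < j)%N) ((j%:R : rat) - i%:R) = \prod_(j < n) (j`!)%:R.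
Proof.
rewrite (exchange_big_dep xpredT) //=; apply: eq_bigr => j _.
by rewrite prod_diff_below // ltnW.
Qed.

Lemma prod_diff_lift n (m : 'I_n.+1) :
  \prod_(i < n) \prod_(j < n | (i < j)%N) ((lift m j)%:R - (lift m i)%:R : rat) *
    (m`! * (n - m)`!)%:R = \prod_(j < n.+1) (j`!)%:R.
Proof.
rewrite -prod_nat_diff [RHS](bigD1_ord m) //= prod_diff_above -1?ltnS //.
rewrite [X in _ = _ * X](eq_bigr (fun i : 'I_n =>
     (if (i < m)%N then (m%:R : rat) - i%:R else 1) *
     \prod_(j < n | (i < j)%N) ((lift m j)%:R - (lift m i)%:R))); last first.
  move=> i _; rewrite big_mkcond (bigD1_ord m) //=; congr (_ * _).
    rewrite /bump; case: (leqP m i) => h /=; first by rewrite ifF //; lia.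
    by rewrite add0n h.
  by rewrite -big_mkcond; apply: eq_bigl => j; rewrite ltnNge leq_bump2 -ltnNge.
rewrite big_split /= -big_mkcond prod_diff_below -1?ltnS // natrM.
by rewrite mulrC mulrCA mulrA.
Qed.

(** The dimension of the irreducible representation of GL_N whose diagram has
    c - p columns of length r and p columns of length r - 1. *)
Definition gl_det N r c p : rat :=
  \det (\matrix_(i, j < c)
        extract ((1 + 'X) ^+ N) (r + c.-1) ('X^(i + (c - p <= i)%N) * gl_col c j)).

(** Taking factorials out of rows and columns leaves a matrix of falling
    factorials. *)
Lemma gl_det_eval N r c p : (0 < r)%N -> (r <= N)%N -> (p <= c)%N ->
  gl_det N r c p * \prod_(i < c) ((r + c.-1 - (i + (c - p <= i)%N))`! *
                                  (N - r + (i + (c - p <= i)%N))`!)%:R =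
  \prod_(j < c) ((N + j)`!)%:R *
  \prod_(i < c) \prod_(j < c | (i < j)%N)
      ((j + (c - p <= j)%N)%:R - (i + (c - p <= i)%N)%:R).
Proof.
move=> r0 rN pc.
pose b (i : 'I_c) := (i + (c - p <= i)%N)%N.
have bc i : (b i <= c)%N by rewrite /b; have := ltn_ord i; case: leqP; lia.
pose k i := (r + c.-1 - b i)%N.
pose y i := (N - r + b i)%N.
pose M := (N + c.-1)%N.
have kM i : (k i <= M)%N by rewrite /k /M; lia.
have yE i : (M - k i)%N = y i by have := bc i; have := ltn_ord i; rewrite /k /y /M; lia.
transitivity (\det (\matrix_(i, j < c) ('C(M - j, k i) * ((k i)`! * (M - k i)`!))%:R : 'M[rat]_c)).
  have -> : (\matrix_(i, j < c) ('C(M - j, k i) * ((k i)`! * (M - k i)`!))%:R : 'M[rat]_c) =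
    diag_mx (\row_i ((k i)`! * (M - k i)`!)%:R) *m
    \matrix_(i, j < c) extract ((1 + 'X) ^+ N) (r + c.-1) ('X^(b i) * gl_col c j).
    apply/matrixP=> i j; rewrite mul_diag_mx !mxE extractXn ifT; last first.
      by have := bc i; have := ltn_ord i; lia.
    rewrite /gl_col -exprD coef_1X natrM mulrC; congr (_ * 'C(_, _)%:R).
    by have := ltn_ord j; rewrite /M; lia.
  rewrite det_mulmx det_diag mulrC; congr (_ * _).
  by apply: eq_bigr => i _; rewrite mxE yE.
have -> : (\matrix_(i, j < c) ('C(M - j, k i) * ((k i)`! * (M - k i)`!))%:R : 'M[rat]_c) =
   (\matrix_(i, j < c) ((y i ^_ j)%:R)) *m diag_mx (\row_j ((M - j)`!)%:R).
  apply/matrixP=> i j; rewrite mul_mx_diag !mxE bin_ffact_sub ?yE //; last first.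
    by have := ltn_ord j; rewrite /M; lia.
  by rewrite natrM mulrC.
rewrite det_mulmx det_diag mulrC det_ffact; congr (_ * _).
  rewrite [RHS](reindex_inj rev_ord_inj); apply: eq_bigr => j _.
  by rewrite mxE /=; congr (_`!%:R); have := ltn_ord j; rewrite /M; lia.
apply: eq_bigr => i _; apply: eq_bigr => j _.
by rewrite /y !natrD; ring.
Qed.

(** The exponents are the numbers 0, ..., c without c - p. Completing each product
    over the exponents to a product over 0, ..., c leaves factors that do not
    depend on p and the contribution of the missing number. *)
Lemma gl_det_scale N r c p : (0 < r)%N -> (r <= N)%N -> (p <= c)%N -> (0 < c)%N ->
  gl_det N r c p * (p`! * (c - p)`!)%:R * ((r.-1)`! * (N - r + c)`!)%:R =
  gl_det N r c 0 * (c`!)%:R * ((r.-1 + p)`! * (N - r + c - p)`!)%:R.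
Proof.
move=> r0 rN pc c0.
pose h x := ((r + c.-1 - x)`! * (N - r + x)`!)%N.
have key q : (q <= c)%N ->
  gl_det N r c q * (q`! * (c - q)`!)%:R * \prod_(x < c.+1) (h x)%:R =
  \prod_(j < c) ((N + j)`!)%:R * \prod_(j < c.+1) (j`!)%:R *
  ((r.-1 + q)`! * (N - r + c - q)`!)%:R.
  move=> qc; have mc : (c - q < c.+1)%N by lia.
  pose m := Ordinal mc.
  have li (i : 'I_c) : lift m i = (i + (c - q <= i)%N)%N :> nat by rewrite /= /bump addnC.
  have e1 := gl_det_eval r0 rN qc.
  have e2 := prod_diff_lift m.
  rewrite (bigD1_ord m) //=.
  have -> : h (c - q)%N = ((r.-1 + q)`! * (N - r + c - q)`!)%N.
    by rewrite /h; congr (_`! * _`!)%N; lia.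
  rewrite -e2 /= subKn //.
  rewrite (eq_bigr (fun i : 'I_c => (h (i + (c - q <= i)%N)%N)%:R)); last first.
    by move=> i _; rewrite -li.
  rewrite [X in _ = _ * (X * _) * _](eq_bigr (fun i : 'I_c => \prod_(j < c | (i < j)%N)
    ((j + (c - q <= j)%N)%:R - (i + (c - q <= i)%N)%:R))); last first.
    by move=> i _; apply: eq_bigr => j _; rewrite -!li.
  rewrite [X in _ = X * _]mulrA -e1 /h [(c - q)`!]lock -lock.
  rewrite [((c - q)`! * q`!)%N]mulnC; ring.
have T0 : \prod_(x < c.+1) (h x)%:R != 0 :> rat.
  by apply/prodf_neq0 => x _; rewrite pnatr_eq0 -lt0n muln_gt0 !fact_gt0.
have := key _ pc; have := key _ (leq0n c); rewrite addn0 !subn0 mul1n => k0 kp.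
apply: (mulIf T0).
transitivity (gl_det N r c p * (p`! * (c - p)`!)%:R * \prod_(x < c.+1) (h x)%:R *
   ((r.-1)`! * (N - r + c)`!)%:R); first by ring.
rewrite kp mulrAC -k0; ring.
Qed.

Lemma prod_col N r j : (r <= N)%N ->
  \prod_(i < r) ((N%:R - i.+1%:R + j.+1%:R) / (i.+1%:R + j.+1%:R - 1)) =
  ((N + j)`! * j`!)%:R / ((N - r + j)`! * (r + j)`!)%:R :> rat.
Proof.
have f0 n : (n`!)%:R != 0 :> rat by rewrite pnatr_eq0 -lt0n fact_gt0.
elim: r => [|r IH] rN.
  by rewrite big_ord0 subn0 add0n divff // natrM mulf_neq0.
rewrite big_ord_recr /= IH; last lia.
have -> : (N - r + j = (N - r.+1 + j).+1)%N by lia.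
rewrite addSn !factS.
have -> : N%:R - r.+1%:R + j.+1%:R = (N - r.+1 + j).+1%:R :> rat.
  by rewrite -!natr1 !natrD natrB // -!natr1; ring.
have -> : r.+1%:R + j.+1%:R - 1 = (r + j).+1%:R :> rat.
  by rewrite -!natr1 natrD; ring.
have n0 n : n.+1%:R != 0 :> rat by rewrite pnatr_eq0.
rewrite !natrM; field.
by rewrite !f0 -!natrD !nat1r !n0.
Qed.

Definition box_product (N r c : nat) : rat :=
  \prod_(1 <= i < r.+1) \prod_(1 <= j < c.+1)
     ((N%:R - i%:R + j%:R) / (i%:R + j%:R - 1)).

Lemma box_product_fact N r c : (r <= N)%N ->
  box_product N r c = \prod_(j < c) (((N + j)`! * j`!)%:R / ((N - r + j)`! * (r + j)`!)%:R).
Proof.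
move=> rN; rewrite /box_product big_add1 big_mkord.
under eq_bigr => i _ do rewrite big_add1 big_mkord.
by rewrite exchange_big; apply: eq_bigr => j _; rewrite /= prod_col.
Qed.

Lemma gl_det0 N r c : (0 < r)%N -> (r <= N)%N -> gl_det N r c 0 = box_product N r c.
Proof.
move=> r0 rN; rewrite box_product_fact // big_split /= prodfV.
have f0 n : (n`!)%:R != 0 :> rat by rewrite pnatr_eq0 -lt0n fact_gt0.
have e := gl_det_eval r0 rN (leq0n c).
have b0 (i : 'I_c) : (i + (c - 0 <= i)%N)%N = i by rewrite subn0 leqNgt ltn_ord addn0.
set X := \prod_(j < c) ((N - r + j)`! * (r + j)`!)%:R.
have X0 : X != 0 by apply/prodf_neq0 => j _; rewrite natrM mulf_neq0.
apply: (mulIf X0); rewrite mulfVK //.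
have XE : X = \prod_(i < c) ((r + c.-1 - (i + (c - 0 <= i)%N))`! *
                                  (N - r + (i + (c - 0 <= i)%N))`!)%:R.
  rewrite /X; under eq_bigr do rewrite natrM.
  under [RHS]eq_bigr do rewrite natrM b0.
  rewrite !big_split /= mulrC; congr (_ * _).
  rewrite (reindex_inj rev_ord_inj); apply: eq_bigr => j _ /=.
  by congr (_`!%:R); have := ltn_ord j; lia.
rewrite XE e; under [RHS]eq_bigr do rewrite natrM.
rewrite big_split /= -prod_nat_diff; congr (_ * _).
by apply: eq_bigr => i _; apply: eq_bigr => j _; rewrite !b0.
Qed.

Lemma gl_det_formula N r c p : (0 < r)%N -> (r <= N)%N -> (p <= c)%N ->
  gl_det N r c p =
  'C(c, p)%:R * ('C(p + r - 1, p)%:R / 'C(N - r + c, p)%:R) * box_product N r c.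
Proof.
move=> r0 rN pc.
case: (posnP c) pc => [->|c0] pc.
  move: pc; rewrite leqn0 => /eqP ->.
  by rewrite gl_det0 // !bin0 divr1 !mul1r.
rewrite -gl_det0 //; have := gl_det_scale r0 rN pc c0.
have f0 n : (n`!)%:R != 0 :> rat by rewrite pnatr_eq0 -lt0n fact_gt0.
have -> : (p + r - 1 = r.-1 + p)%N by lia.
have e1 : (c`!)%:R = 'C(c, p)%:R * ((p`!)%:R * ((c - p)`!)%:R) :> rat.
  by rewrite -!natrM bin_fact.
have e2 : ((r.-1 + p)`!)%:R = 'C(r.-1 + p, p)%:R * ((p`!)%:R * (r.-1`!)%:R) :> rat.
  by rewrite -!natrM -{3}(addnK p r.-1) bin_fact // leq_addl.
have e3 : ((N - r + c)`!)%:R = 'C(N - r + c, p)%:R * ((p`!)%:R * ((N - r + c - p)`!)%:R) :> rat.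
  by rewrite -!natrM bin_fact //; lia.
have b0 : 'C(N - r + c, p)%:R != 0 :> rat by rewrite pnatr_eq0 -lt0n bin_gt0; lia.
rewrite !natrM e1 e2 e3 => e.
have F0 : (p`!)%:R * ((c - p)`!)%:R * ((r.-1`!)%:R * ('C(N - r + c, p)%:R * ((p`!)%:R *
  ((N - r + c - p)`!)%:R))) != 0 :> rat by rewrite !mulf_neq0.
apply: (mulIf F0); rewrite [LHS]mulrA e; field.
by [].
Qed.

(** The Chu-Vandermonde identity for negative upper indices. *)
Lemma sum_bin_vandermonde a b c :
  (\sum_(p < c.+1) 'C(p + a, p) * 'C(b + (c - p), c - p) = 'C(a + b + c.+1, c))%N.
Proof.
elim: b c => [|b IHb] c.
  rewrite addn0; under eq_bigr do rewrite add0n binn muln1.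
  elim: c => [|c IH]; first by rewrite big_ord_recl big_ord0 !bin0.
  rewrite big_ord_recr /= IH [RHS](_ : _ = 'C((a + c.+1).+1, c.+1)); last first.
    by congr 'C(_, _); lia.
  by rewrite binS addnC [(c.+1 + a)%N]addnC.
elim: c => [|c IHc]; first by rewrite big_ord_recl big_ord0 !bin0.
rewrite (_ : a + b.+1 + c.+2 = (a + b + c.+2).+1)%N; last lia.
rewrite binS -IHb (_ : a + b + c.+2 = a + b.+1 + c.+1)%N; last lia.
rewrite -IHc big_ord_recr [in RHS]big_ord_recr /= !subnn !bin0. rewrite [RHS]addnAC; congr addn.
rewrite -big_split; apply: eq_bigr => p _ /=.
rewrite -mulnDr; congr muln.
by rewrite subSn -1?ltnS // [in LHS]addnS binS -[(b + _.+1)%N]addSnnS.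
Qed.

(** The dimension identity of the branching rule from GL_(N+1) to GL_N for the
    rectangle with r rows and c columns. *)
Lemma sum_gl_formula N r c : (0 < r)%N -> (r <= N)%N ->
  \sum_(p < c.+1) 'C(c, p)%:R * ('C(p + r - 1, p)%:R / 'C(N - r + c, p)%:R) * box_product N r c
  = box_product N.+1 r c.
Proof.
move=> r0 rN.
have f0 n : (n`!)%:R != 0 :> rat by rewrite pnatr_eq0 -lt0n fact_gt0.
have b0 n m : (m <= n)%N -> 'C(n, m)%:R != 0 :> rat.
  by move=> mn; rewrite pnatr_eq0 -lt0n bin_gt0.
have -> : box_product N.+1 r c = box_product N r c * ('C(N + c, c)%:R / 'C(N - r + c, c)%:R).
  rewrite !box_product_fact 1?leqW //.
  elim: c => [|c IH]; first by rewrite !big_ord0 !bin0 mul1r divff.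
  have n0 n : n.+1%:R != 0 :> rat by rewrite pnatr_eq0.
  rewrite !big_ord_recr /= IH.
  have binE n : 'C(n.+1, c.+1)%:R = n.+1%:R * 'C(n, c)%:R / c.+1%:R :> rat.
    by apply: (mulIf (n0 c)); rewrite mulfVK // -!natrM mulnC -mul_bin_diag.
  rewrite !addnS !binE subSn // !addSn !factS !natrM; field.
  by rewrite !f0 !b0 ?leq_addl // -?natrD !nat1r !n0.
rewrite -mulr_suml mulrC; congr (_ * _).
have -> : 'C(N + c, c) = 'C(r.-1 + (N - r) + c.+1, c) by congr 'C(_, _); lia.
rewrite -sum_bin_vandermonde natr_sum mulr_suml; apply: eq_bigr => p _.
rewrite -addnBA // subn1 natrM -mulrA mulrCA; congr (_ * _).
have pc : (p <= c)%N by rewrite -ltnS.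
have e1 n m : (m <= n)%N -> 'C(n, m)%:R = (n`!)%:R / ((m`!)%:R * ((n - m)`!)%:R) :> rat.
  by move=> mn; rewrite -(bin_fact mn) !natrM mulfK // mulf_neq0.
rewrite !e1 //; try lia.
rewrite !addnK.
rewrite (_ : N - r + (c - p) = N - r + c - p)%N; last lia.
field; rewrite !f0 //.
Qed.

(** * Column parities and alternating sums *)

Lemma nth_le_head (s : seq nat) i : sorted geq s -> (nth 0 s i <= head 0 s)%N.
Proof.
case: s => [|x s] /=; first by rewrite nth_nil.
move=> srt; have {srt} /allP h := order_path_min (rev_trans leq_trans) srt.
case: i => //= i; case: (ltnP i (size s)) => si; last by rewrite nth_default.
exact: h (mem_nth _ si).
Qed.

Lemma leq_nth_count (s : seq nat) i j : sorted geq s -> (0 < j)%N ->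
  (j <= nth 0 s i)%N = (i < count (leq j) s)%N.
Proof.
elim: s i => [|x s IH] i srt j0; first by rewrite nth_nil leqNgt j0.
have ss : sorted geq s := path_sorted srt.
case: (leqP j x) => jx /=.
  by rewrite jx; case: i => //= i; rewrite IH.
rewrite (leqNgt j x) jx add0n.
have -> : count (leq j) s = 0%N.
  apply/eqP; rewrite -leqn0 leqNgt -has_count; apply/hasPn => y ys /=.
  rewrite -ltnNge; apply: leq_ltn_trans jx.
  by have /allP := order_path_min (rev_trans leq_trans) srt; apply.
by rewrite ltn0; apply/negbTE; rewrite -ltnNge; apply: leq_ltn_trans jx; apply: (nth_le_head _ srt).
Qed.

(** A column of length l contributes an alternating sum of l signs, which only
    depends on the parity of l. *)
Lemma sum_sign_prefix (r l : nat) : (l <= r)%N ->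
  \sum_(i < r) (-1) ^+ (r - i) * (i < l)%N%:Z = (-1) ^+ r * (odd l)%:Z :> int.
Proof.
move=> lr.
have -> : \sum_(i < r) (-1) ^+ (r - i) * (i < l)%N%:Z =
  (-1) ^+ r * \sum_(i < l) (-1) ^+ i :> int.
  rewrite (big_ord_widen_cond r xpredT (fun i => (-1) ^+ i)) // [in RHS]big_mkcond mulr_sumr.
  apply: eq_bigr => i _ /=; case: (ltnP i l) => il; rewrite ?mulr0 // mulr1.
  by rewrite -signr_odd oddB ?(ltnW (ltn_ord i)) // signr_addb !signr_odd.
congr (_ * _); elim: l {lr} => [|l IH]; first by rewrite big_ord0.
by rewrite big_ord_recr /= IH -signr_odd; case: (odd l).
Qed.

Lemma Posz_sum (I : Type) (s : seq I) (F : I -> nat) :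
  (\sum_(i <- s) F i)%N%:Z = \sum_(i <- s) (F i)%:Z.
Proof. exact: (big_morph Posz PoszD erefl). Qed.

Lemma sum_leq m n : (n <= m)%N -> (\sum_(j <- iota 1 m) (j <= n) = n)%N.
Proof.
move=> nm; have -> : iota 1 m = index_iota 1 m.+1 by rewrite /index_iota subn1.
rewrite big_add1 big_mkord.
elim: m n nm => [|m IH] n; first by rewrite leqn0 => /eqP->; rewrite big_ord0.
rewrite big_ord_recr /=; case: (ltngtP n m.+1) => // [nm|->] _.
  by rewrite IH // addn0.
rewrite (eq_bigr (fun i : 'I_m => (i < m)%N : nat)) ?IH ?addn1 // => i _.
by rewrite ltn_ord ltnS ltnW.
Qed.

Lemma alternating_sum_levels (la : seq nat) (r := size la) :
  sorted geq la ->
  \sum_(i < r) (-1) ^+ (r - i) * (nth 0%N la i)%:Z =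
  (-1) ^+ r * (\sum_(l <- columns la) odd l)%N%:Z :> int.
Proof.
move=> srt; rewrite /columns big_map Posz_sum mulr_sumr.
transitivity (\sum_(j <- iota 1 (head 0%N la)) \sum_(i < r)
    (-1) ^+ (r - i) * (i < count (leq j) la)%N%:Z : int).
  rewrite exchange_big; apply: eq_bigr => i _ /=.
  rewrite -{1}(sum_leq (nth_le_head i srt)) Posz_sum mulr_sumr.
  rewrite big_seq [RHS]big_seq; apply: eq_bigr => j; rewrite mem_iota => /andP[j0 _].
  by rewrite leq_nth_count.
by apply: eq_bigr => j _; rewrite sum_sign_prefix // count_size.
Qed.

(** For odd r the omitted first entry is the number of columns, and each odd
    column contributes -1 to the full alternating sum. *)
Lemma off_parity_columns (la : seq nat) : sorted geq la -> (0 < size la)%N ->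
  (off_parity (size la) (columns la))%:Z =
  if odd (size la) then \sum_(2 <= i < (size la).+1)
         (-1) ^+ (size la - i + 1) * (nth 0%N la i.-1)%:Z
  else \sum_(1 <= i < (size la).+1)
         (-1) ^+ (size la - i + 1) * (nth 0%N la i.-1)%:Z :> int.
Proof.
move=> srt s0; have := alternating_sum_levels srt; set r := size la => e.
have {}e : \sum_(1 <= i < r.+1) (-1) ^+ (r - i + 1) * (nth 0%N la i.-1)%:Z =
   (-1) ^+ r * (\sum_(l <- columns la) odd l)%N%:Z :> int.
  rewrite -e big_add1 big_mkord; apply: eq_bigr => i _; congr (_ ^+ _ * _).
  by rewrite addn1 subnSK //; exact: ltn_ord i.
rewrite /off_parity -sum1_count big_mkcond.
case: ifP => odd_r; last first.
  rewrite e -signr_odd odd_r mul1r; congr Posz; apply: eq_bigr => l _.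
  by case: (odd l).
rewrite big_ltn // in e.
have -> : \sum_(2 <= i < r.+1) (-1) ^+ (r - i + 1) * (nth 0%N la i.-1)%:Z =
  (head 0%N la)%:Z - (\sum_(l <- columns la) odd l)%N%:Z :> int.
  move: e; rewrite -[(-1) ^+ r]signr_odd odd_r subnK // -signr_odd odd_r nth0.
  by rewrite expr1 !mulN1r => <-; rewrite addrA subrr add0r.
apply/eqP; rewrite eq_sym subr_eq -PoszD eqz_nat -big_split /=.
rewrite (eq_bigr (fun=> 1%N)) ?sum1_size ?size_map ?size_iota // => l _.
by case: (odd l).
Qed.

Lemma off_parity_box c (la : seq nat) :
  off_parity (size la) (box_columns c la) =
  (off_parity (size la) (columns la) + odd (size la) * (c - head 0 la))%N.
Proof. by rewrite /off_parity /box_columns count_cat count_nseq; case: (odd _). Qed.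

Lemma off_parity_boxE c (la : seq nat) : sorted geq la -> (head 0 la <= c)%N ->
  off_parity (size la) (box_columns c la) =
  (\sum_(j < c) (odd (count (leq j.+1) la) != odd (size la)))%N.
Proof.
move=> srt hc; rewrite /off_parity.
have -> : box_columns c la = [seq count (leq j) la | j <- iota 1 c].
  rewrite /box_columns /columns -{2}(subnKC hc) iotaD map_cat; congr cat.
  apply: (@eq_from_nth _ 0%N); rewrite size_nseq ?size_map ?size_iota // => i ih.
  rewrite nth_nseq ih (nth_map 0%N) ?size_iota // nth_iota //.
  have := @leq_nth_count la 0 (1 + head 0%N la + i) srt isT.
  have -> : (1 + head 0%N la + i <= nth 0%N la 0)%N = false by rewrite nth0; lia.
  by case: count.
rewrite -sum1_count big_map big_mkcond.
have -> : iota 1 c = index_iota 1 c.+1 by rewrite /index_iota subn1.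
by rewrite big_add1 big_mkord; apply: eq_bigr => j _; case: (_ != _).
Qed.

Lemma diagonalE N r c (a : filling N r c) : (r.*2 <= N.+1)%N ->
  diagonal a = [seq entry a i i | i <- iota 0 r].
Proof.
move=> rN; rewrite /diagonal.
have rleN : (r <= N)%N by lia.
have -> : iota 0 r = [seq i <- iota 0 N | (i < r)%N].
  by rewrite -(filter_iota_ltn 0 rleN).
rewrite -val_enum_ord filter_map -map_comp.
rewrite (eq_pmap (f2 := fun i : 'I_N => if (i < r)%N then Some (entry a i i) else None)).
  elim: (enum 'I_N) => //= i s ->.
  by case: ifP.
move=> i; case: insubP => [x xP xE|]; last first.
  rewrite /in_trapezoid /= leqnn => h; rewrite ifF //; apply/negbTE.
  by apply: contra h => ir; rewrite ir /=; lia.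
by rewrite /= -(entryE a x) xE /=; case/and3P: xP => /= ->.
Qed.

Lemma size_diagonal N r c (a : filling N r c) : (r.*2 <= N.+1)%N -> size (diagonal a) = r.
Proof. by move=> rN; rewrite diagonalE // size_map size_iota. Qed.

Lemma sorted_diagonal N r c (a : filling N r c) : (r.*2 <= N.+1)%N ->
  plane_partition a -> sorted geq (diagonal a).
Proof.
move=> rN pp; rewrite diagonalE // sorted_map.
apply: (sub_sorted (e := ltn)) (iota_ltn_sorted 0 r) => i j ij /=.
by have := @entry_diag _ _ _ a i j 0 pp (ltnW ij); rewrite !addn0.
Qed.

Lemma head_diagonal N r c (a : filling N r c) : (r.*2 <= N.+1)%N ->
  (head 0%N (diagonal a) <= c)%N.
Proof. by move=> rN; rewrite diagonalE //; case: r a rN => //= r a _; apply: entry_le. Qed.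

Lemma count_diagonal N r c (a : filling N r c) (j : 'I_c) : (r.*2 <= N.+1)%N ->
  count (leq j.+1) (diagonal a) = to_family a ord0 j.
Proof.
move=> rN; rewrite diagonalE // to_familyE count_map -val_enum_ord count_map.
rewrite -sum1_count big_enum_cond -sum1_card.
by apply: eq_bigl => i; rewrite !inE /= addn0.
Qed.

Definition off_columns c r (v : {ffun 'I_c -> 'I_r.+1}) : nat :=
  (\sum_i (odd (v i) != odd r))%N.

Lemma off_parity_diagonal N r c (a : filling N r c) : (r.*2 <= N.+1)%N ->
  plane_partition a ->
  off_parity r (box_columns c (diagonal a)) = off_columns (to_family a ord0).
Proof.
move=> rN pp; have := @off_parity_boxE c _ (sorted_diagonal rN pp) (head_diagonal a rN).
rewrite size_diagonal // => ->; apply: eq_bigr => j _.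
by rewrite count_diagonal.
Qed.

Lemma noninc_to_family N r c (a : filling N r c) : plane_partition a ->
  noninc (to_family a ord0).
Proof. by case/valid_to_family/andP => /forallP/(_ ord0)/andP[]. Qed.

(** * The enumeration *)

Lemma count_by_off N r c p : (0 < r)%N -> (r.*2 <= N.+1)%N ->
  #|[set a : filling N r c | plane_partition a &&
       (off_parity r (box_columns c (diagonal a)) == p)]|%:R =
  if (p <= c)%N then gl_det N r c p else 0 :> rat.
Proof.
move=> r0 rN.
have -> : [set a : filling N r c | plane_partition a &&
       (off_parity r (box_columns c (diagonal a)) == p)] =
   [set a : filling N r c | plane_partition a &&
       (noninc (to_family a ord0) && (off_columns (to_family a ord0) == p))].
  apply/setP => a; rewrite !inE; case pp : (plane_partition a) => //=.
  by rewrite noninc_to_family // off_parity_diagonal.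
rewrite (@sum_plane_partitions N r c (fun v => noninc v && (off_columns v == p))) natr_sum.
rewrite -linear_sum_single -sum_sp_det; apply: eq_bigr => v /andP[dv _].
apply: chains_det; rewrite /admissible dv; apply/forallP => i.
by apply: (@leq_trans r); [exact: (ltn_ord (v i)) | lia].
Qed.

Theorem theorem4 (N r c : nat) (hr : (0 < r)%N) (hN : (r.*2 <= N.+1)%N) :
  [/\ (forall (a : filling N r c) (p : nat), plane_partition a ->
         (off_parity r (columns (diagonal a)) = p <->
            if odd r
            then \sum_(2 <= i < r.+1)
                   (-1) ^+ (r - i + 1) * (diag_entry a i)%:Z = p%:Z
            else \sum_(1 <= i < r.+1)
                   (-1) ^+ (r - i + 1) * (diag_entry a i)%:Z = p%:Z)
         /\
         (off_parity r (box_columns c (diagonal a)) = p <->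
            if odd r
            then (c%:Z - (diag_entry a 1)%:Z)
                 + \sum_(2 <= i < r.+1)
                     (-1) ^+ (r - i + 1) * (diag_entry a i)%:Z = p%:Z
            else \sum_(1 <= i < r.+1)
                   (-1) ^+ (r - i + 1) * (diag_entry a i)%:Z = p%:Z)),
      (forall p : nat,
         #|[set a : filling N r c |
              [&& plane_partition a,
                  sorted geq (diagonal a)
                & off_parity r (box_columns c (diagonal a)) == p]]|%:R
         = 'C(c, p)%:R * ('C(p + r - 1, p)%:R / 'C(N - r + c, p)%:R)
           * \prod_(1 <= i < r.+1) \prod_(1 <= j < c.+1)
               ((N%:R - i%:R + j%:R) / (i%:R + j%:R - 1)) :> rat)
    & #|[set a : filling N r c | plane_partition a]|%:R
      = \prod_(1 <= i < r.+1) \prod_(1 <= j < c.+1)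
          ((N%:R + 1 - i%:R + j%:R) / (i%:R + j%:R - 1)) :> rat].
Proof.
have rN : (r <= N)%N by lia.
split.
- move=> a p pp.
  have srt := sorted_diagonal hN pp; have sz := size_diagonal a hN.
  have := off_parity_columns srt; rewrite sz => /(_ hr) off.
  have := off_parity_box c (diagonal a); rewrite sz => ->.
  have hd := head_diagonal a hN.
  have d1 : diag_entry a 1 = head 0%N (diagonal a) by rewrite /diag_entry nth0.
  have off_iff (m : nat) (z : int) : m%:Z = z -> (m = p <-> z = p%:Z).
    by move=> <-; split => [->|[]].
  case: (odd r) off => off.
    split; apply: off_iff; first exact: off.
    by rewrite mul1n PoszD off d1 -subzn // addrC.
  by split; apply: off_iff; rewrite ?mul0n ?addn0 off.
- move=> p.
  have -> : [set a : filling N r c | [&& plane_partition a, sorted geq (diagonal a)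
               & off_parity r (box_columns c (diagonal a)) == p]] =
     [set a : filling N r c | plane_partition a &&
       (off_parity r (box_columns c (diagonal a)) == p)].
    apply/setP => a; rewrite !inE; case pp : (plane_partition a) => //=.
    by rewrite sorted_diagonal.
  rewrite count_by_off //; case: leqP => pc; first by rewrite gl_det_formula.
  by rewrite bin_small // !mul0r.
have off_le (a : filling N r c) : plane_partition a ->
    (off_parity r (box_columns c (diagonal a)) <= c)%N.
  move=> pp; rewrite off_parity_diagonal // -[X in (_ <= X)%N]card_ord -sum1_card.
  by apply: leq_sum => i _; apply: leq_b1.
have -> : #|[set a : filling N r c | plane_partition a]| =
    (\sum_(p < c.+1) #|[set a : filling N r c | plane_partition a &&
       (off_parity r (box_columns c (diagonal a)) == p)]|)%N.
  rewrite -sum1_card (partition_big (fun a : filling N r c =>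
    inord (off_parity r (box_columns c (diagonal a))) : 'I_c.+1) xpredT) //=.
  apply: eq_bigr => p _; rewrite -sum1_card; apply: eq_bigl => a; rewrite !inE.
  case pp : (plane_partition a) => //=.
  by rewrite -val_eqE /= inordK // ltnS off_le.
rewrite natr_sum (eq_bigr (fun p : 'I_c.+1 =>
  'C(c, p)%:R * ('C(p + r - 1, p)%:R / 'C(N - r + c, p)%:R) * box_product N r c)).
  rewrite sum_gl_formula // /box_product.
  by apply: eq_bigr => i _; apply: eq_bigr => j _; rewrite -natr1.
by move=> p _; rewrite count_by_off // -ltnS ltn_ord gl_det_formula // -ltnS.
Qed.
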